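(* There is an algorithm that, given an instance $(G,R,t,k)$ of Steiner Tree in which $G$ is an $n$-vertex clique-grid graph, $R\subseteq V(G)$ is a set of $t$ terminals and $k$ is a positive integer, decides whether $(G,R,t,k)$ is a yes-instance in time $2^{O(k)}n^{O(1)}$. In particular, Steiner Tree on clique-grid graphs is fixed-parameter tractable when parameterized by $k$.
   Context: Steiner Tree: the input $(G,R,t,k)$ consists of a graph $G$ on $n$ vertices (unweighted), a set $R\subseteq V(G)$ with $|R|=t$ whose elements are called terminals, and a positive integer $k$. The question is whether there is a tree $T$ that is a subgraph of $G$ with $R\subseteq V(T)$ and $|V(T)\setminus R|\le k$. Write $[m]=\{1,\dots,m\}$. A graph $G$ is a clique-grid graph if there are $p,p'\in\mathbb{N}$ and a function $f:V(G)\to[p]\times[p']$ such that (1) for all $(i,j)\in[p]\times[p']$, $f^{-1}(i,j)$ is a clique in $G$; and (2) for all $uv\in E(G)$, if $f(u)=(i,j)$ and $f(v)=(i',j')$ then $|i-i'|\le 2$ and $|j-j'|\le 2$. Such an $f$ is called a representation of $G$. *)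

(* Defs.v *)
From mathcomp Require Import all_boot all_order all_algebra.

Set Implicit Arguments.
Unset Strict Implicit.
Unset Printing Implicit Defensive.

(* The model of computation is a structured unit-cost RAM.  The memory consists
   of arrays of unbounded naturals; a program refers to arrays by literal
   identifiers, so it uses finitely many of them, and a scalar variable is cell
   0 of an array.  The arithmetic is additive only (truncated subtraction, no
   multiplication or shift), so, apart from the fixed constants of the program,
   one time unit lengthens the largest number in play by at most one bit.  Hence
   the model and Turing machines simulate each other with polynomial overhead,
   under which bounds of the form 2^{O(k)} n^{O(1)} are preserved. *)

Definition memory := nat -> nat -> nat.

Definition mem_update (s : memory) (a i v : nat) : memory :=
  fun b j => if (b == a) && (j == i) then v else s b j.

Inductive expr : Type :=
  | Const of nat
  | Read of nat & expr
  | Add of expr & expr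
  | Sub of expr & expr.

Fixpoint eval (s : memory) (e : expr) : nat :=
  match e with
  | Const c => c
  | Read a e1 => s a (eval s e1)
  | Add e1 e2 => eval s e1 + eval s e2
  | Sub e1 e2 => eval s e1 - eval s e2
  end.

Fixpoint expr_cost (e : expr) : nat :=
  match e with
  | Const _ => 1
  | Read _ e1 => (expr_cost e1).+1
  | Add e1 e2 | Sub e1 e2 => (expr_cost e1 + expr_cost e2).+1
  end.

(* [Write a e1 e2] stores the value of [e2] in cell [e1] of array [a]; the
   tests of [If] and [While] succeed on nonzero values. *)
Inductive program : Type :=
  | Skip
  | Write of nat & expr & expr
  | Seq of program & program
  | If of expr & program & program
  | While of expr & program.

(* [exec P s time s'] : started in memory [s], [P] halts after exactly [time]
   steps in memory [s']. *)
Inductive exec : program -> memory -> nat -> memory -> Prop :=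
  | exec_skip s : exec Skip s 1 s
  | exec_write a e1 e2 s :
      exec (Write a e1 e2) s (expr_cost e1 + expr_cost e2).+1
           (mem_update s a (eval s e1) (eval s e2))
  | exec_seq P1 P2 s s1 s2 t1 t2 :
      exec P1 s t1 s1 -> exec P2 s1 t2 s2 ->
      exec (Seq P1 P2) s (t1 + t2) s2
  | exec_if_true e P1 P2 s s' t :
      eval s e != 0 -> exec P1 s t s' ->
      exec (If e P1 P2) s (expr_cost e + t).+1 s'
  | exec_if_false e P1 P2 s s' t :
      eval s e = 0 -> exec P2 s t s' ->
      exec (If e P1 P2) s (expr_cost e + t).+1 s'
  | exec_while_false e P s :
      eval s e = 0 -> exec (While e P) s (expr_cost e).+1 s
  | exec_while_true e P s s1 s2 t1 t2 :
      eval s e != 0 -> exec P s t1 s1 -> exec (While e P) s1 t2 s2 ->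
      exec (While e P) s (expr_cost e + t1 + t2).+1 s2.

Definition output (s : memory) : nat := s 0 0.

Definition computable (f : nat -> nat) : Prop :=
  exists P : program, forall x : nat,
    exists time s', exec P (mem_update (fun _ _ => 0) 0 0 x) time s' /\
                    output s' = f x.

Record graph (n : nat) : Type := Graph {
  adj : rel 'I_n;
  adj_sym : symmetric adj;
  adj_irrefl : irreflexive adj }.

Definition clique n (G : graph n) (A : {set 'I_n}) : Prop :=
  forall u v, u \in A -> v \in A -> u != v -> adj G u v.

(* [p] is represented by 'I_p; the shift of indices by one is immaterial. *)
Definition representation n (G : graph n) (p p' : nat)
    (f : 'I_n -> 'I_p * 'I_p') : Prop :=
  (forall ij : 'I_p * 'I_p', clique G [set u | f u == ij]) /\
  (forall u v, adj G u v ->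
     `|(f u).1 - (f v).1|%N <= 2 /\ `|(f u).2 - (f v).2|%N <= 2).

Definition clique_grid n (G : graph n) : Prop :=
  exists (p p' : nat) (f : 'I_n -> 'I_p * 'I_p'), representation G f.

(* (W, F) is the subgraph with vertex set W and edge relation F. *)
Definition subgraph n (G : graph n) (W : {set 'I_n}) (F : rel 'I_n) : Prop :=
  symmetric F /\
  (forall u v, F u v -> [/\ u \in W, v \in W & adj G u v]).

Definition connected n (W : {set 'I_n}) (F : rel 'I_n) : Prop :=
  W != set0 /\ {in W &, forall u v, connect F u v}.

(* [ucycle F [:: u; v]] holds for every edge uv, hence the bound 3. *)
Definition acyclic n (F : rel 'I_n) : Prop :=
  forall c : seq 'I_n, ucycle F c -> size c < 3.

Definition tree n (W : {set 'I_n}) (F : rel 'I_n) : Prop :=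
  connected W F /\ acyclic F.

Definition steiner_yes n (G : graph n) (R : {set 'I_n}) (k : nat) : Prop :=
  exists (W : {set 'I_n}) (F : rel 'I_n),
    [/\ subgraph G W F, tree W F, R \subset W & #|W :\: R| <= k].

(* Cell 0 of arrays 0, 1, 2 holds n, t, k; array 3 is the indicator vector of
   R; array 4 is the adjacency matrix, row by row.  No representation of G is
   part of the input. *)
Definition encode n (G : graph n) (R : {set 'I_n}) (t k : nat) : memory :=
  fun a i =>
    match a with
    | 0 => if i == 0 then n else 0
    | 1 => if i == 0 then t else 0
    | 2 => if i == 0 then k else 0
    | 3 => [exists u : 'I_n, (i == u) && (u \in R)]
    | 4 => [exists u : 'I_n, exists v : 'I_n, (i == u * n + v) && adj G u v]
    | _ => 0
    end.

(* Nothing is required of [P] when G is not a clique-grid graph. *)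
Definition solves_steiner_clique_grid (P : program)
    (bound : nat -> nat -> nat) : Prop :=
  forall (n : nat) (G : graph n) (R : {set 'I_n}) (t k : nat),
    clique_grid G -> #|R| = t -> 0 < k ->
    exists (time : nat) (s' : memory) (answer : bool),
      [/\ exec P (encode G R t k) time s',
          time <= bound k n,
          output s' = answer
        & answer <-> steiner_yes G R k].

(* n.+1 rather than n only serves to cover n = 0. *)
Definition steiner_clique_grid_FPT : Prop :=
  exists (P : program) (f : nat -> nat) (d : nat),
    computable f /\ solves_steiner_clique_grid P (fun k n => f k * n.+1 ^ d).

(* Main.v *)
Require Import Defs.
From mathcomp Require Import all_boot ssrint zify.

(** Every component of G[R] is contracted to its least vertex, its
    representative.  A nonterminal has its neighbours in at most 25 cells, each
    cell is a clique, and therefore it touches at most 25 components: a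
    yes-instance has at most 25k representatives, and all other instances are
    rejected.  Let c be the number of representatives and Q = 2^(51k).  The i-th
    representative gets the token Q + 2^i, each nonterminal Q + 2^c, each other
    terminal 0.  A dynamic program computes which sums of tokens are attained by
    connected multisets of vertices containing a given vertex.  A sum equal to
    that of all representatives plus J tokens of nonterminals forces c + J
    nonzero tokens, hence every representative and exactly J nonterminals: thus
    multiplicities and overlaps need not be tracked, and the table has
    2^O(k) * n entries. *)

(** Merging two connected sets may reuse vertices, and remembering the nonterminals used would take
    n^O(k) states. A sum does not see overlaps, so its value must certify afterwards that they did
    no harm. The digits 2^i alone cannot do this, because two copies of 2^i imitate 2^(i+1). Such a
    substitution uses more tokens, and the summand Q counts them, provided that the digit parts
    never carry into the multiples of Q; this is the condition (c + J + 1) 2^c <= Q.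

    Terminals other than representatives weigh 0 because all of R is added to the solution in the
    end. The geometry enters only through the bound 25k, so no representation has to be found. The
    table is built only after c has passed the test against 25k, which keeps its size single
    exponential in k. *)

Set Implicit Arguments.
Unset Strict Implicit.
Unset Printing Implicit Defensive.

(** * For-programs *)

(* [Loop i b P] runs [P] for [i] from 0 below the value of scalar [b].  [static]
   makes [den] the exact meaning of the compiled loops, and makes their bounds
   constant, so that running times can be read off the syntax. *)
Inductive stmt : Type :=
  | Nop
  | Asg of nat & expr & expr
  | Sq of stmt & stmt
  | Cnd of expr & stmt & stmt
  | Loop of nat & nat & stmt.

Definition scalar (a : nat) : expr := Read a (Const 0).

Fixpoint compile (P : stmt) : program :=
  match P with
  | Nop => Skip
  | Asg a e1 e2 => Write a e1 e2
  | Sq P1 P2 => Seq (compile P1) (compile P2)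
  | Cnd e P1 P2 => If e (compile P1) (compile P2)
  | Loop i b P1 =>
      Seq (Write i (Const 0) (Const 0))
          (While (Defs.Sub (scalar b) (scalar i))
             (Seq (compile P1)
                  (Write i (Const 0) (Add (scalar i) (Const 1)))))
  end.

Definition incr (i : nat) (s : memory) : memory :=
  mem_update s i 0 (s i 0 + 1).

Fixpoint den (P : stmt) (s : memory) : memory :=
  match P with
  | Nop => s
  | Asg a e1 e2 => mem_update s a (eval s e1) (eval s e2)
  | Sq P1 P2 => den P2 (den P1 s)
  | Cnd e P1 P2 => if eval s e != 0 then den P1 s else den P2 s
  | Loop i b P1 =>
      iter (s b 0) (fun s1 => incr i (den P1 s1)) (mem_update s i 0 0)
  end.

Fixpoint writes (P : stmt) : seq nat :=
  match P with
  | Nop => [::]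
  | Asg a _ _ => [:: a]
  | Sq P1 P2 | Cnd _ P1 P2 => writes P1 ++ writes P2
  | Loop i _ P1 => i :: writes P1
  end.

Fixpoint bounds (P : stmt) : seq nat :=
  match P with
  | Nop | Asg _ _ _ => [::]
  | Sq P1 P2 | Cnd _ P1 P2 => bounds P1 ++ bounds P2
  | Loop _ b P1 => b :: bounds P1
  end.

Fixpoint counters_free (P : stmt) : bool :=
  match P with
  | Nop | Asg _ _ _ => true
  | Sq P1 P2 | Cnd _ P1 P2 => counters_free P1 && counters_free P2
  | Loop i _ P1 => (i \notin writes P1) && counters_free P1
  end.

Definition static (P : stmt) : bool :=
  counters_free P && all (fun b => b \notin writes P) (bounds P).

(** The 20 covers the overhead of a loop: 3 steps to reset the counter, 6 for the failing test, and
    12 per round for test and increment. *)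
Fixpoint weight (P : stmt) : nat :=
  match P with
  | Nop => 1
  | Asg _ e1 e2 => (expr_cost e1 + expr_cost e2).+1
  | Sq P1 P2 => weight P1 + weight P2
  | Cnd e P1 P2 => (expr_cost e + (weight P1 + weight P2)).+1
  | Loop _ _ P1 => 20 + weight P1
  end.

Fixpoint depth (P : stmt) : nat :=
  match P with
  | Nop | Asg _ _ _ => 0
  | Sq P1 P2 | Cnd _ P1 P2 => maxn (depth P1) (depth P2)
  | Loop _ _ P1 => (depth P1).+1
  end.

Lemma updE s a i v b j :
  mem_update s a i v b j = if (b == a) && (j == i) then v else s b j.
Proof. by []. Qed.

Lemma upd_same s a i v : mem_update s a i v a i = v.
Proof. by rewrite updE !eqxx. Qed.

Lemma upd_other s a i v b j : b != a -> mem_update s a i v b j = s b j.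
Proof. by rewrite updE => /negbTE ->. Qed.

Lemma den_frame P s a j : a \notin writes P -> den P s a j = s a j.
Proof.
elim: P s => [|b e1 e2|P1 IH1 P2 IH2|e P1 IH1 P2 IH2|i b P1 IH] s //=.
- by rewrite inE => ?; rewrite upd_other.
- by rewrite mem_cat negb_or => /andP[h1 h2]; rewrite IH2 // IH1.
- by rewrite mem_cat negb_or => /andP[h1 h2]; case: ifP => _; rewrite ?IH2 ?IH1.
- rewrite inE negb_or => /andP[h1 h2].
  elim: (s b 0) => [|N IHN] /=; first by rewrite upd_other.
  by rewrite /incr upd_other // IH.
Qed.

Lemma static_sub P1 P2 P :
  writes P = writes P1 ++ writes P2 -> bounds P = bounds P1 ++ bounds P2 ->
  counters_free P = counters_free P1 && counters_free P2 ->
  static P -> static P1 /\ static P2.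
Proof.
rewrite /static => -> -> ->; rewrite all_cat => /andP[/andP[-> ->]] /=.
move=> /andP[h1 h2]; split.
- by apply: sub_all h1 => b; rewrite mem_cat negb_or => /andP[].
- by apply: sub_all h2 => b; rewrite mem_cat negb_or => /andP[].
Qed.

Lemma static_loop i b P :
  static (Loop i b P) ->
  [/\ static P, i \notin writes P, b \notin writes P & i != b].
Proof.
rewrite /static /= inE negb_or => /andP[/andP[-> ->]] /= /andP[/andP[h1 ->]] h2.
split=> //; last by rewrite eq_sym.
by apply: sub_all h2 => c; rewrite inE negb_or => /andP[].
Qed.

Section LoopRules.
Variables (i b : nat) (P : stmt).
Hypotheses (iP : i \notin writes P) (bP : b \notin writes P) (ib : i != b).

Let body s := incr i (den P s).

Lemma loop_counter s j :
  iter j body (mem_update s i 0 0) i 0 = j /\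
  iter j body (mem_update s i 0 0) b 0 = s b 0.
Proof.
elim: j => [|j [IH1 IH2]] /=; first by rewrite upd_same upd_other // eq_sym.
rewrite /body /incr upd_same upd_other 1?eq_sym // !den_frame //.
by rewrite IH1 IH2 addn1.
Qed.

Lemma loop_ind (I : nat -> memory -> Prop) s :
  I 0 (mem_update s i 0 0) ->
  (forall j s1, j < s b 0 -> s1 i 0 = j -> I j s1 -> I j.+1 (incr i (den P s1))) ->
  I (s b 0) (den (Loop i b P) s).
Proof.
move=> I0 IS; have: s b 0 <= s b 0 by [].
(* The selected occurrences are the number of rounds already run; the bound of the loop stays
   fixed. *)
rewrite [den _ _]/=; elim: {1 3 4}(s b 0) => [|j IH] //= hj.
by apply: IS => //; [case: (loop_counter s j) | apply: IH; lia].
Qed.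

(* Rule for monotone loops: the goal [G j] reached by round [j] survives the
   later rounds because it is monotone for the preorder [le]. *)
Lemma loop_all (I : memory -> Prop) (le : memory -> memory -> Prop)
    (G : nat -> memory -> Prop) s :
  (forall s1 s2 s3, le s1 s2 -> le s2 s3 -> le s1 s3) ->
  (forall s1 v, le s1 (mem_update s1 i 0 v)) ->
  (forall s1 v, I s1 -> I (mem_update s1 i 0 v)) ->
  (forall j s1 s2, le s1 s2 -> G j s1 -> G j s2) ->
  I s ->
  (forall j s1, j < s b 0 -> s1 i 0 = j -> I s1 ->
     [/\ I (den P s1), le s1 (den P s1) & G j (den P s1)]) ->
  [/\ I (den (Loop i b P) s), le s (den (Loop i b P) s)
    & forall j, j < s b 0 -> G j (den (Loop i b P) s)].
Proof.
move=> letr leu Iu Gm Is IS.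
pose J j s1 := [/\ I s1, le s s1 & forall j', j' < j -> G j' s1].
apply: (loop_ind (I := J)) => [|j s1 hj h1 [I1 l1 G1]].
  by split=> //; exact: Iu.
have [I2 l2 G2] := IS j s1 hj h1 I1.
split; first exact: Iu.
- exact: letr l1 (letr _ _ _ l2 (leu _ _)).
move=> j'; rewrite ltnS leq_eqVlt => /orP[/eqP->|/G1 h].
  exact: Gm (leu _ _) G2.
exact: Gm (leu _ _) (Gm _ _ _ l2 h).
Qed.

End LoopRules.

Lemma exec_den P s M :
  static P -> (forall b, b \in bounds P -> s b 0 <= M) ->
  exists2 t, exec (compile P) s t (den P s) & t <= weight P * M.+1 ^ depth P.
Proof.
elim: P s => [|a e1 e2|P1 IH1 P2 IH2|e P1 IH1 P2 IH2|i b P1 IH] s st hM.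
- by exists 1; [exact: exec_skip | rewrite expn0].
- by eexists; [exact: exec_write | rewrite expn0 muln1].
- have [s1 s2] := static_sub (P := Sq P1 P2) erefl erefl erefl st.
  have [|t1 h1 l1] := IH1 s s1; first by move=> b hb; apply: hM; rewrite mem_cat hb.
  have [|t2 h2 l2] := IH2 (den P1 s) s2.
    move=> b hb; rewrite den_frame; first by apply: hM; rewrite mem_cat hb orbT.
    move: st => /andP[_ /allP /(_ b)]; rewrite /= !mem_cat hb orbT negb_or.
    by move=> /(_ isT) /andP[].
  exists (t1 + t2); first exact: exec_seq h1 h2.
  rewrite /= mulnDl leq_add //.
  + by apply: leq_trans l1 _; rewrite leq_mul2l leq_pexp2l ?orbT ?leq_maxl.
  + by apply: leq_trans l2 _; rewrite leq_mul2l leq_pexp2l ?orbT ?leq_maxr.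
- have [s1 s2] := static_sub (P := Cnd e P1 P2) erefl erefl erefl st.
  have [|t1 h1 l1] := IH1 s s1; first by move=> b hb; apply: hM; rewrite mem_cat hb.
  have [|t2 h2 l2] := IH2 s s2; first by move=> b hb; apply: hM; rewrite mem_cat hb orbT.
  have k1 : t1 <= weight P1 * M.+1 ^ depth (Cnd e P1 P2).
    by apply: leq_trans l1 _; rewrite leq_mul2l leq_pexp2l ?orbT ?leq_maxl.
  have k2 : t2 <= weight P2 * M.+1 ^ depth (Cnd e P1 P2).
    by apply: leq_trans l2 _; rewrite leq_mul2l leq_pexp2l ?orbT ?leq_maxr.
  have k0 : 0 < M.+1 ^ depth (Cnd e P1 P2) by rewrite expn_gt0.
  rewrite [weight _]/= [compile _]/=.
  case he: (eval s e != 0).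
  + exists (expr_cost e + t1).+1.
      by rewrite /= he; apply: exec_if_true.
    by set X := _ ^ _ in k1 k2 k0 *; nia.
  + exists (expr_cost e + t2).+1.
      by rewrite /= he; apply: exec_if_false h2; apply/eqP; rewrite -[_ == _]negbK he.
    by set X := _ ^ _ in k1 k2 k0 *; nia.
- have [s1 iP bP ib] := static_loop st.
  set B := weight P1 * M.+1 ^ depth P1.
  pose body s := incr i (den P1 s).
  pose st0 j := iter j body (mem_update s i 0 0).
  have cnt j : st0 j i 0 = j /\ st0 j b 0 = s b 0 by apply: loop_counter.
  (* [While] unrolls its first round and [iter] its last, so the induction is on the number [d] of
     rounds still to run. *)
  have run d : d <= s b 0 ->
      exists2 t, exec (While (Defs.Sub (scalar b) (scalar i))
             (Seq (compile P1) (Write i (Const 0) (Add (scalar i) (Const 1)))))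
           (st0 (s b 0 - d)) t (st0 (s b 0)) & t <= 6 + d * (13 + B).
    elim: d => [|d IHd] hd.
      rewrite subn0; exists 6; last lia.
      by apply: (@exec_while_false (Defs.Sub (scalar b) (scalar i))); have [/= -> ->] := cnt (s b 0); rewrite subnn.
    have [|t ht lt] := IHd; first lia.
    have [|t1 h1 l1] := IH (st0 (s b 0 - d.+1)) s1.
      move=> c hc; suff -> : st0 (s b 0 - d.+1) c 0 = s c 0 by apply: hM; rewrite inE hc orbT.
      have cP : (c \notin writes P1) && (c != i).
        move: st => /andP[_ /allP /(_ c)]; rewrite /= !inE hc orbT negb_or.
        by move=> /(_ isT) /andP[-> ->].
      move/andP: cP => [cP ci].
      elim: (_ - _) => [|j IHj] /=; first by rewrite upd_other.
      by rewrite /body /incr upd_other // den_frame.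
    exists (expr_cost (Defs.Sub (scalar b) (scalar i)) + (t1 + 6) + t).+1; last by move: l1; rewrite -/B /=; lia.
    apply: exec_while_true ht.
    + by have [/= -> ->] := cnt (s b 0 - d.+1); lia.
    + have -> : s b 0 - d = (s b 0 - d.+1).+1 by lia.
      rewrite /st0 /= -/(st0 _); apply: exec_seq h1 _; exact: exec_write.
  have [|t ht lt] := run (s b 0); first by [].
  rewrite subnn in ht.
  exists (3 + t); first by apply: exec_seq ht; exact: exec_write.
  have hb : s b 0 <= M by apply: hM; rewrite inE eqxx.
  rewrite /= expnS.
  have k0 : 0 < M.+1 ^ depth P1 by rewrite expn_gt0.
  have : 3 + t <= M.+1 * (20 + B) by nia.
  by move=> /leq_trans; apply; rewrite /B; set X := _ ^ _ in k0 *; nia.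
Qed.

(** * Induced connectivity and components *)

(** Source of the 25: within distance 2 of [x] a coordinate has five possible offsets, and two
    coordinates give 5 * 5. Adding 2 first keeps the truncated subtraction exact. *)
Lemma offset_inj (a b x : nat) :
  `|a - x| <= 2 -> `|b - x| <= 2 ->
  inord (a + 2 - x) = inord (b + 2 - x) :> 'I_5 -> a = b.
Proof. by move=> h1 h2 /(congr1 val) /=; rewrite !inordK; lia. Qed.

Section Graphs.
Variables (n : nat) (G : graph n).
Implicit Types (A W R : {set 'I_n}) (u v x y : 'I_n).

Definition induced W : rel 'I_n :=
  fun u v => [&& u \in W, v \in W & adj G u v].

Lemma induced_sym W : symmetric (induced W).
Proof. by move=> u v; rewrite /induced adj_sym andbCA. Qed.

(** Connectivity is used through cuts: if G[W] is connected, a set that no edge of G[W] leaves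
    contains all of [W] as soon as it meets [W]. *)
Definition closed_in W A :=
  forall x y, x \in A -> x \in W -> y \in W -> adj G x y -> y \in A.

Lemma connect_closed_in W A u v :
  closed_in W A -> connect (induced W) u v -> u \in A -> v \in A.
Proof.
move=> clA /connectP[p]; elim: p u => [|w p IH] u /=; first by move=> _ ->.
move=> /andP[/and3P[uW wW uw]] pp vp uA; apply: IH pp vp _.
exact: clA uA uW wW uw.
Qed.

Definition induced_connected W := connected W (induced W).

Lemma induced_connected_sub W A v :
  induced_connected W -> v \in W -> v \in A -> closed_in W A -> W \subset A.
Proof.
move=> [_ cW] vW vA clA; apply/subsetP => x xW.
exact: connect_closed_in clA (cW v x vW xW) vA.
Qed.

Lemma induced_connectedI W v :
  v \in W -> (forall A, v \in A -> closed_in W A -> W \subset A) ->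
  induced_connected W.
Proof.
move=> vW cut; split; first by apply/set0Pn; exists v.
have /subsetP sub : W \subset [set x | connect (induced W) v x].
  apply: cut; first by rewrite inE connect0.
  move=> x y; rewrite !inE => vx xW yW xy.
  by apply: connect_trans vx (connect1 _); rewrite /induced xW yW.
move=> x y /sub; rewrite inE => vx /sub; rewrite inE; apply: connect_trans.
by rewrite (sym_connect_sym (@induced_sym W)).
Qed.

Lemma induced_connected1 v : induced_connected [set v].
Proof.
apply: (@induced_connectedI _ v) => [|A vA _]; first by rewrite inE.
by rewrite sub1set.
Qed.

Lemma closed_in_sub W W' A : W' \subset W -> closed_in W A -> closed_in W' A.
Proof. by move=> /subsetP s cl x y xA /s xW /s yW; apply: cl. Qed.

Lemma induced_connectedU W1 W2 u v :
  induced_connected W1 -> induced_connected W2 -> v \in W1 -> u \in W2 ->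
  adj G v u -> induced_connected (W1 :|: W2).
Proof.
move=> c1 c2 v1 u2 vu; apply: (@induced_connectedI _ v) => [|A vA cl].
  by rewrite inE v1.
rewrite subUset (induced_connected_sub c1 v1 vA); last first.
  by apply: closed_in_sub cl; apply: subsetUl.
apply: (induced_connected_sub c2 u2); last first.
  by apply: closed_in_sub cl; apply: subsetUr.
by apply: cl vA _ _ vu; rewrite inE ?v1 ?u2 ?orbT.
Qed.

Lemma exit_edge W A v z :
  induced_connected W -> v \in W -> v \in A -> z \in W -> z \notin A ->
  exists x y, [/\ x \in A, x \in W, y \in W, y \notin A & adj G x y].
Proof.
move=> cW vW vA zW zA.
case: (boolP [exists x, exists y,
   [&& x \in A, x \in W, y \in W, y \notin A & adj G x y]]).
  by move=> /existsP[x /existsP[y /and5P[]]]; exists x, y.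
rewrite negb_exists => /forallP h; case/negP: zA.
apply: (subsetP (induced_connected_sub cW vW vA _)) zW => x y xA xW yW xy.
move: (h x); rewrite negb_exists => /forallP /(_ y).
by rewrite xA xW yW xy /= andbT negbK.
Qed.

(** Undoes one merging step. [W2] is the component of a neighbour [u] of [v] in G[W - v]; inside [W]
    its edges can leave it only towards [v], so the rest stays connected. *)
Lemma connected_split W v z :
  induced_connected W -> v \in W -> z \in W -> z != v ->
  exists W1 W2 u, [/\ W = W1 :|: W2, [disjoint W1 & W2],
    induced_connected W1 /\ v \in W1, induced_connected W2 /\ u \in W2
    & adj G v u].
Proof.
move=> cW vW zW zv.
have zv' : z \notin [set v] by rewrite inE.
have [v' [u [/set1P-> _ uW uv vu]]] := exit_edge cW vW (set11 v) zW zv'.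
rewrite inE in uv.
pose U := [set x in W | connect (induced (W :\ v)) u x & x != v].
have uU : u \in U by rewrite inE uW connect0 uv.
have vU : v \notin U by rewrite inE eqxx !andbF.
have UW : U \subset W by apply/subsetP => x; rewrite inE => /and3P[].
have nbU x y : x \in U -> y \in W -> y != v -> adj G x y -> y \in U.
  rewrite !inE => /and3P[xW ux xv] yW yv xy; rewrite yW yv andbT /=.
  by apply: connect_trans ux (connect1 _); rewrite /induced !inE xW yW xv yv.
exists (W :\: U), U, u; split=> //.
- by apply/setP => x; rewrite !inE; case: (x \in W) => //=; rewrite andbT orNb.
- by rewrite disjoint_sym disjoints_subset; apply/subsetP => x xU; rewrite inE inE xU.
- split; last by rewrite inE vU.
  apply: (@induced_connectedI _ v) => [|A vA cl]; first by rewrite inE vU.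
  (* A set closed in the rest becomes closed in [W] once [U] is added, because the only exit [v] of
     [U] already lies in [A]. *)
  have cl' : closed_in W (A :|: U).
    move=> x y; rewrite !(in_setU x) => /orP[xA|xU] xW yW xy.
      case yU: (y \in U); first by rewrite inE yU orbT.
      case xU: (x \in U).
        have [->|yv] := eqVneq y v; first by rewrite inE vA.
        by rewrite inE (nbU x y) ?orbT.
      by rewrite inE (cl x y) // inE ?xU ?yU.
    have [->|yv] := eqVneq y v; first by rewrite inE vA.
    by rewrite inE (nbU x y) ?orbT.
  have vAU : v \in A :|: U by rewrite inE vA.
  have /subsetP s := induced_connected_sub cW vW vAU cl'.
  by apply/subsetP => x; rewrite inE => /andP[/negbTE xU /s]; rewrite inE xU orbF.
- split=> //; apply: (@induced_connectedI _ u) => // A uA cl.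
  apply/subsetP => x xU.
  suff: x \in A :&: U by rewrite inE => /andP[].
  have ux : connect (induced (W :\ v)) u x by move: xU; rewrite inE => /and3P[].
  apply: connect_closed_in ux _; last by rewrite inE uA uU.
  move=> a b; rewrite !(inE, in_setI A) => /andP[aA aU] _ /andP[bv bW] ab.
  have aU' : a \in U by rewrite inE.
  have bU := nbU a b aU' bW bv ab.
  by have := cl a b aA aU' bU ab; move: bU; rewrite inE => -> ->.
Qed.

(** The tree grows by one edge leaving it at a time; the new vertex is a leaf and thus lies on no
    cycle. *)
Lemma spanning_tree W : induced_connected W ->
  exists2 F, subgraph G W F & tree W F.
Proof.
move=> cW; have [/set0Pn[v0 vW] _] := cW.
suff H j : j < #|W| -> exists (S : {set 'I_n}) (F : rel 'I_n),
    [/\ S \subset W, #|S| = j.+1, v0 \in S, subgraph G S F & tree S F].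
  have [|S [F [SW cS _ sF tF]]] := H #|W|.-1.
    by rewrite prednK // card_gt0; case: cW.
  have <- : S = W by apply/eqP; rewrite eqEcard SW cS; lia.
  by exists F.
elim: j => [|j IH] hj.
  exists [set v0], (fun _ _ => false); split; rewrite ?sub1set ?cards1 ?inE //.
  split; first split; first by apply/set0Pn; exists v0; rewrite inE.
    by move=> x y /set1P-> /set1P->.
  by move=> [|x [|y c]] //; rewrite /ucycle /=.
have [|S [F [SW cS vS [sF eF] [[S0 cF] aF]]]] := IH; first lia.
have [z zW zS] : exists2 z, z \in W & z \notin S.
  have: ~~ (W \subset S) by apply/negP => /subset_leq_card; lia.
  by move=> /subsetPn[z zW zS]; exists z.
have [x [w [xS xW wW wS xw]]] := exit_edge cW vW vS zW zS.
pose F' : rel 'I_n := fun a b => [|| F a b, (a == x) && (b == w) | (a == w) && (b == x)].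
have subF : subrel (connect F) (connect F').
  by apply: connect_sub => a b ab; apply: connect1; rewrite /F' ab.
have sF' : symmetric F'.
  by move=> a b; rewrite /F' sF (andbC (b == x)) (andbC (b == w)) (orbC (_ && _)).
have Fw a : F' w a -> a = x.
  rewrite /F' eqxx; case/or3P => [/eF[wS'] |/andP[/eqP wx _]|/eqP] //.
    by rewrite wS' in wS.
  by move: wS; rewrite wx xS.
exists (w |: S), F'; split.
- by rewrite subUset sub1set wW.
- by rewrite cardsU1 wS cS.
- by rewrite inE vS orbT.
- split=> // a b; rewrite /F' !inE => /or3P[/eF[-> -> ->]||].
  + by rewrite !orbT.
  + by move=> /andP[/eqP-> /eqP->]; rewrite eqxx xS orbT.
  + by move=> /andP[/eqP-> /eqP->]; rewrite eqxx xS orbT adj_sym.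
- split; last first.
    move=> c ucc; rewrite ltnNge; apply/negP => c3.
    case: (boolP (w \in c)) => wc; last first.
      suff /aF : ucycle F c by rewrite ltnNge c3.
      case/andP: ucc => cc uc; rewrite /ucycle uc andbT.
      apply: (sub_in_cycle (P := predC1 w)) cc => [a b|].
        rewrite !inE /F' => aw bw.
        by rewrite (negbTE aw) (negbTE bw) andbF !orbF.
      by apply/allP => a ac; apply: contraNneq wc => <-.
    (* Rotated to start at the leaf [w], the cycle has its second and its last vertex both equal to
       [x], against uniqueness. *)
    have [i c' rc] := rot_to wc.
    move: ucc c3; rewrite -(rot_ucycle i) -(size_rot i) rc.
    case: c' {rc} => [|a [|b c']] //=.
    rewrite /ucycle /= rcons_path => /andP[/and3P[/Fw-> _ /andP[_ lw]]].
    move: lw; rewrite sF' => /Fw lx /andP[_ /andP[]].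
    by rewrite -{1}lx mem_last.
  split; first by apply/set0Pn; exists w; rewrite !inE eqxx.
  have hub a : a \in w |: S -> connect F' x a.
    rewrite !inE => /orP[/eqP->|aS]; last by apply: subF; apply: cF.
    by apply: connect1; rewrite /F' !eqxx orbT.
  move=> a b /hub xa /hub; apply: connect_trans.
  by rewrite (sym_connect_sym sF').
Qed.

Lemma steiner_yesP R k :
  steiner_yes G R k <->
  exists W, [/\ induced_connected W, R \subset W & #|W :\: R| <= k].
Proof.
split=> [[W [F [[_ eF] [[W0 cF] _] RW Wk]]]|[W [cW RW Wk]]]; last first.
  by have [F sF tF] := spanning_tree cW; exists W, F.
exists W; split=> //; split=> // u v uW vW.
apply: (connect_sub _ (cF u v uW vW)) => x y /eF[xW yW xy].
by apply: connect1; rewrite /induced xW yW.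
Qed.

(** * Components of the terminals and their number *)

Section Components.
Variable R : {set 'I_n}.

Definition representatives : {set 'I_n} :=
  [set v in R | [forall u, connect (induced R) v u ==> (v <= u)]].

Lemma representatives_sub : representatives \subset R.
Proof. by apply/subsetP => v; rewrite inE => /andP[]. Qed.

Lemma representatives_uniq u v :
  u \in representatives -> v \in representatives ->
  connect (induced R) u v -> u = v.
Proof.
rewrite !inE => /andP[_ /forallP/(_ v)/implyP hu] /andP[_ /forallP/(_ u)/implyP hv].
move=> uv; apply/val_inj/eqP; rewrite eqn_leq hu //= hv //.
by rewrite (sym_connect_sym (@induced_sym R)).
Qed.

Lemma connect_induced_mem u v : connect (induced R) u v -> u \in R -> v \in R.
Proof. by apply: connect_closed_in => x y. Qed.

Lemma representatives_cover v : v \in R ->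
  exists2 r, r \in representatives & connect (induced R) v r.
Proof.
move=> vR; case: (arg_minnP val (connect0 (induced R) v)) => r vr rmin.
exists r => //; rewrite inE (connect_induced_mem vr vR).
by apply/forallP => u; apply/implyP => /(connect_trans vr) /rmin.
Qed.

(** The reason why only representatives need a token: every other terminal reaches the
    representative of its component inside G[R]. *)
Lemma induced_connected_terminals S :
  induced_connected S -> representatives \subset S ->
  induced_connected (S :|: R).
Proof.
move=> cS rS; have [/set0Pn[v vS] _] := cS.
apply: (@induced_connectedI _ v) => [|A vA cl]; first by rewrite inE vS.
have SA : S \subset A.
  by apply: induced_connected_sub cS vS vA _; apply: closed_in_sub cl; apply: subsetUl.
rewrite subUset SA; apply/subsetP => x xR.
have [r rr xr] := representatives_cover xR.
apply: connect_closed_in (subsetP SA r (subsetP rS r rr)).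
  by apply: closed_in_sub cl; apply: subsetUr.
by rewrite (sym_connect_sym (@induced_sym R)).
Qed.

(* A nonterminal sees at most 25 cells, and the terminals of one cell lie in
   the same component of G[R]. *)
Lemma card_representatives W k :
  clique_grid G -> induced_connected W -> R \subset W -> #|W :\: R| <= k ->
  0 < k -> #|representatives| <= 25 * k.
Proof.
move=> [p [p' [f [fcl fadj]]]] cW RW Wk k0.
(* A component is sure to have a leaving edge only when there is another one; a single
   representative is covered by [k0]. *)
case: (leqP #|representatives| 1) => [|r2]; first by lia.
have ex r : r \in representatives -> exists xw : 'I_n * 'I_n,
    [&& xw.2 \in W :\: R, connect (induced R) r xw.1, xw.1 \in R & adj G xw.1 xw.2].
  move=> rr.
  have rR := subsetP representatives_sub r rr.
  have [r' r'r r'n] : exists2 r', r' \in representatives & r' != r.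
    have: 0 < #|representatives :\ r| by move: r2; rewrite (cardsD1 r) rr; lia.
    by move=> /card_gt0P[r']; rewrite !inE => /andP[h1 h2]; exists r'; rewrite ?inE.
  have r'R := subsetP representatives_sub r' r'r.
  have [||||x [w [xA xW wW wA xw]]] := @exit_edge W [set x | connect (induced R) r x] r r' cW.
  - exact: (subsetP RW).
  - by rewrite inE connect0.
  - exact: (subsetP RW).
  - rewrite inE; apply: contraNN r'n => rc; apply/eqP/esym; exact: representatives_uniq.
  rewrite !inE in xA wA.
  have xR := connect_induced_mem xA rR.
  exists (x, w); rewrite /= !inE xA xR xw wW !andbT.
  apply: contraNN wA => wR; apply: connect_trans xA (connect1 _).
  by rewrite /induced xR wR.
have v0 : 'I_n by have : 0 < #|representatives| by [lia]; move=> /card_gt0P/sigW[].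
pose g r := odflt (v0, v0) [pick xw : 'I_n * 'I_n | 
    [&& xw.2 \in W :\: R, connect (induced R) r xw.1, xw.1 \in R & adj G xw.1 xw.2]].
have gP r : r \in representatives -> [/\ (g r).2 \in W :\: R,
    connect (induced R) r (g r).1, (g r).1 \in R & adj G (g r).1 (g r).2].
  by move=> /ex[xw hxw]; rewrite /g; case: pickP => [? /and4P[] //|/(_ xw)]; rewrite hxw.
pose off (a b : nat) : 'I_5 := inord (a + 2 - b).
(* A representative is charged to a nonterminal next to its component, together with the cell of the
   adjacent terminal relative to that of the nonterminal. Equal charges put both terminals into one
   clique, hence into one component. *)
pose h r := ((g r).2, (off (f (g r).1).1 (f (g r).2).1, off (f (g r).1).2 (f (g r).2).2)).
have hinj : {in representatives &, injective h}.
  move=> r r' rr r'r [ew e1 e2].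
  have [_ rx xR xw] := gP r rr; have [_ rx' xR' xw'] := gP r' r'r.
  rewrite -ew in xw' e1 e2.
  have [a1 a2] := fadj _ _ xw; have [b1 b2] := fadj _ _ xw'.
  have ef : f (g r).1 = f (g r').1.
    rewrite (surjective_pairing (f _)) (surjective_pairing (f (g r').1)).
    by congr (_, _); apply/val_inj; [exact: offset_inj e1 | exact: offset_inj e2].
  apply: representatives_uniq => //; apply: connect_trans rx _.
  have -> : connect (induced R) (g r).1 r' = connect (induced R) r' (g r).1.
    by rewrite (sym_connect_sym (@induced_sym R)).
  apply: connect_trans rx' _.
  have [->|ne] := eqVneq (g r').1 (g r).1; first exact: connect0.
  apply: connect1; rewrite /induced xR xR'.
  by apply: (fcl (f (g r).1)); rewrite ?inE ?ef.
rewrite -(card_in_imset hinj).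
apply: leq_trans (_ : #|setX (W :\: R) [set: 'I_5 * 'I_5]| <= _).
  apply: subset_leq_card; apply/subsetP => _ /imsetP[r rr ->].
  by rewrite inE in_setT andbT; have [] := gP r rr.
by rewrite cardsX cardsT card_prod !card_ord mulnC leq_mul2l Wk orbT.
Qed.

End Components.

End Graphs.

(** * Token sums *)

(* [c + J] is the least number of powers of two, none above [2 ^ c], with this
   sum, and only one choice attains it. *)
Lemma digits_unique c J (m : nat -> nat) :
  \sum_(i < c.+1) m i <= c + J ->
  \sum_(i < c.+1) m i * 2 ^ i = \sum_(i < c) 2 ^ i + J * 2 ^ c ->
  (forall i, i < c -> m i = 1) /\ m c = J.
Proof.
elim: c m => [|c IH] m.
  by rewrite !big_ord1 big_ord0 /= expn0 => _ h; split=> //; lia.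
rewrite big_ord_recl [in X in _ -> X -> _]big_ord_recl /=.
under [X in _ -> _ + X = _ -> _]eq_bigr => i _ do rewrite /bump /= add1n expnS mulnCA.
rewrite -big_distrr /= [\sum_(i < c.+1) 2 ^ i]big_ord_recl /=.
under [X in _ -> _ = _ + X + _ -> _]eq_bigr => i _ do rewrite /bump /= add1n expnS.
rewrite -big_distrr /= expnS expn0 muln1 => hs hv.
(* By parity m 0 is odd, say 2a + 1. Trading 2a units at position 0 for a units at position 1 saves
   a summands; the induction hypothesis makes the number of summands exactly c + J, which leaves no
   room for a saving, so a = 0. *)
pose a := (m 0)./2.
pose m' i := m i.+1 + (if i == 0 then a else 0).
have e1 : \sum_(i < c.+1) m' i = \sum_(i < c.+1) m i.+1 + a.
  rewrite big_split /=; congr (_ + _).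
  by rewrite big_ord_recl /= big1 ?addn0.
have e2 : \sum_(i < c.+1) m' i * 2 ^ i = \sum_(i < c.+1) m i.+1 * 2 ^ i + a.
  under eq_bigr => i _ do rewrite mulnDl.
  rewrite big_split /=; congr (_ + _).
  by rewrite big_ord_recl /= expn0 muln1 big1 ?addn0.
have e3 : \sum_(i < c.+1) m (bump 0 i) = \sum_(i < c.+1) m i.+1 by [].
rewrite e3 in hs.
set S1 := \sum_(i < c.+1) m i.+1 in hs e1.
set S2 := \sum_(i < c.+1) m i.+1 * 2 ^ i in hv e2.
set S3 := \sum_(i < c) 2 ^ i in hv.
have m0 : m 0 = a.*2.+1.
  by rewrite /a; move: hv; rewrite (mulnCA J); lia.
have hv' : \sum_(i < c.+1) m' i * 2 ^ i = S3 + J * 2 ^ c.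
  by rewrite e2; move: hv; rewrite (mulnCA J); lia.
have [|I1 I2] := IH m' _ hv'; first by rewrite e1; lia.
have e4 : \sum_(i < c.+1) m' i = c + J.
  rewrite big_ord_recr /= I2; congr (_ + _).
  by rewrite (eq_bigr (fun => 1)) => [|i _]; rewrite ?I1 ?ltn_ord ?sum1_card ?card_ord.
have a0 : a = 0 by lia.
have m'E i : m' i = m i.+1 by rewrite /m' a0 if_same addn0.
split; last by rewrite -m'E.
by move=> [|i] hi; [rewrite m0 a0 | rewrite -m'E I1].
Qed.

Section Tokens.
Variables (n : nat) (G : graph n) (R : {set 'I_n}) (Q : nat).
Implicit Types (W : {set 'I_n}) (u v x : 'I_n).

Let reps := representatives G R.
Let c := #|reps|.

(** Defined at every natural number, since it also describes the state of the numbering loop after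
    [j] vertices. *)
Definition rank_below (j : nat) : nat := #|[set r in reps | r < j]|.

Definition token v : nat :=
  if v \in R then if v \in reps then Q + 2 ^ rank_below v else 0
  else Q + 2 ^ c.

Definition target J : nat := \sum_(v in reps) token v + J * (Q + 2 ^ c).

Lemma rank_below_inj : {in reps &, injective (fun v => rank_below v)}.
Proof.
suff lt u v : u \in reps -> u < v -> rank_below u < rank_below v.
  move=> u v hu hv /= e; apply: val_inj; case: (ltngtP u v) => //.
    by move=> /(lt _ _ hu); rewrite e ltnn.
  by move=> /(lt _ _ hv); rewrite e ltnn.
move=> hu uv; rewrite /rank_below; apply: proper_card; apply/properP; split.
  by apply/subsetP => x; rewrite !inE => /andP[->] /ltn_trans; apply.
by exists u; rewrite inE ?hu ?uv ?ltnn ?andbF.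
Qed.

Lemma rank_below_lt v : v \in reps -> rank_below v < c.
Proof.
move=> hv; rewrite /rank_below /c; apply: proper_card; apply/properP; split.
  by apply/subsetP => x; rewrite !inE => /andP[].
by exists v; rewrite // inE ltnn andbF.
Qed.

Let level v := if v \in R then rank_below v else c.
Let T := [set v | (v \in reps) || (v \notin R)].

Let memT v : (v \in T) = (v \in reps) || (v \notin R).
Proof. exact: in_set. Qed.

Let level_le v : v \in T -> level v <= c.
Proof.
rewrite memT /level; case vR: (v \in R) => //; rewrite orbF => hv.
exact: ltnW (rank_below_lt hv).
Qed.

Let tokenE v : token v = if v \in T then Q + 2 ^ level v else 0.
Proof.
by rewrite /token memT /level; case vR: (v \in R); case vr: (v \in reps) => //=.
Qed.

(** [F] is abstract so that a single regrouping by level yields both the number of tokens and the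
    sum of their digit parts. *)
Let sum_level (F : nat -> nat -> nat) (m : 'I_n -> nat) :
  (forall i, F^~ i 0 = 0) -> (forall i, {morph F^~ i : x y / x + y}) ->
  \sum_(v in T) F (m v) (level v) =
  \sum_(i < c.+1) F (\sum_(v in T | level v == i) m v) i.
Proof.
move=> F0 FD.
rewrite (partition_big (fun v => inord (level v) : 'I_c.+1) predT) //=.
apply: eq_bigr => i _; rewrite (big_morph (F^~ i) (FD i) (F0 i)).
rewrite (eq_bigl (fun v => (v \in T) && (level v == i))) => [|v]; last first.
  case vT: (v \in T) => //=; apply/eqP/eqP => [<-|e]; last by apply: val_inj; rewrite /= inordK // ltnS level_le.
  by rewrite inordK // ltnS level_le.
by apply: eq_bigr => v /andP[_ /eqP->].
Qed.

Lemma target_repr :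
  target 0 = c * Q + \sum_(i < c) 2 ^ i.
Proof.
rewrite /target mul0n addn0.
rewrite (eq_bigr (fun v => Q + 2 ^ rank_below v)) => [|v hv]; last first.
  by rewrite /token hv (subsetP (representatives_sub G R) v hv).
rewrite big_split /= sum_nat_const; congr (_ + _).
case: (posnP c) => [c0|c0].
  by rewrite c0 big_ord0 big_pred0 // => v; apply: card0_eq c0 v.
pose h v : 'I_c.-1.+1 := inord (rank_below v).
have hK v : v \in reps -> h v = rank_below v :> nat.
  by move=> hv; rewrite inordK // prednK // rank_below_lt.
have hi : {in reps &, injective h}.
  move=> u v hu hv /(congr1 val) /= e; apply: rank_below_inj => //.
  by rewrite -!hK.
rewrite (eq_bigr (fun v => 2 ^ h v)) => [|v hv]; last by rewrite hK.
rewrite -(big_imset (fun i : 'I__ => 2 ^ i) hi) /=.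
have -> : h @: reps = setT.
  by apply/eqP; rewrite eqEcard subsetT cardsT card_ord (card_in_imset hi) (prednK c0) leqnn.
rewrite (eq_bigl predT) => [|i]; last by rewrite inE.
by rewrite -(big_mkord predT (fun i => 2 ^ i)) prednK // big_mkord.
Qed.

(** Write the sum as N * Q + A with N nonzero tokens and digit part A. More than c + J tokens would
    overshoot, as the digit part of the target is below Q. Then A <= N * 2^c is below Q as well, and
    comparing remainders modulo Q leaves the equation of [digits_unique]. *)
Lemma multiset_target (m : 'I_n -> nat) J :
  (c + J).+1 * 2 ^ c <= Q ->
  \sum_v m v * token v = target J ->
  (forall v, v \in reps -> 0 < m v) /\ \sum_(v | v \notin R) m v = J.
Proof.
move=> hQ hs.
pose mm i := \sum_(v in T | level v == i) m v.
set N := \sum_(v in T) m v.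
have eN : N = \sum_(i < c.+1) mm i.
  exact: (@sum_level (fun a _ => a) m (fun => erefl) (fun _ _ _ => erefl)).
set A := \sum_(i < c.+1) mm i * 2 ^ i.
have eA : \sum_(v in T) m v * 2 ^ level v = A.
  exact: (@sum_level (fun a i => a * 2 ^ i) m (fun => mul0n _) (fun _ _ _ => mulnDl _ _ _)).
have es : \sum_v m v * token v = N * Q + A.
  rewrite -eA /N big_distrl /= -big_split /= [RHS]big_mkcond /=.
  by apply: eq_bigr => v _; rewrite tokenE; case: ifP => _; rewrite ?muln0 // mulnDr.
set B := \sum_(i < c) 2 ^ i + J * 2 ^ c.
have et : target J = (c + J) * Q + B.
  by move: target_repr; rewrite /target mul0n addn0 => ->; rewrite /B !mulnDl mulnDr; lia.
have lB : B < (c + J).+1 * 2 ^ c.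
  have : \sum_(i < c) 2 ^ i < 2 ^ c.
    by have := predn_exp 2 c; rewrite mul1n => <-; rewrite prednK ?expn_gt0.
  by rewrite /B; nia.
have lN : N <= c + J.
  rewrite leqNgt; apply/negP => hN; move: hs; rewrite es et.
  have : (c + J).+1 * Q <= N * Q by rewrite leq_mul2r hN orbT.
  by rewrite mulSn; lia.
have lA : A <= N * 2 ^ c.
  rewrite eN big_distrl /=; apply: leq_sum => i _.
  by rewrite leq_mul2l leq_pexp2l ?orbT // -ltnS.
have AQ : A < Q.
  apply: leq_ltn_trans lA _; apply: leq_ltn_trans (_ : (c + J) * 2 ^ c < Q).
    by rewrite leq_mul2r lN orbT.
  by apply: leq_trans hQ; rewrite ltn_pmul2r ?expn_gt0.
have eAB : A = B.
  have BQ : B < Q by apply: leq_trans lB hQ.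
  move: hs; rewrite es et => /(congr1 (modn^~ Q)).
  by rewrite !modnMDl !modn_small.
have [|m1 mJ] := digits_unique _ eAB; first by rewrite -eN.
(* Back to vertices: each level below c belongs to a single representative, and level c to the
   nonterminals. *)
split.
  move=> v hv; have := m1 _ (rank_below_lt hv); rewrite /mm.
  rewrite (bigD1 v) /=; last first.
    by rewrite memT hv /level (subsetP (representatives_sub G R) v hv) eqxx.
  rewrite big1 ?addn0 => [->//|x /andP[/andP[xT /eqP lx] xv]].
  move: xT lx; rewrite memT /level; case xR: (x \in R).
    by rewrite orbF => hx /(rank_below_inj hx hv) xv'; rewrite xv' eqxx in xv.
  by move=> _ e; have := rank_below_lt hv; rewrite -e ltnn.
rewrite -mJ /mm; apply: eq_bigl => v; rewrite memT /level.
case vR: (v \in R); rewrite ?orbT ?eqxx //= orbF.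
by case hv: (v \in reps) => //=; have := rank_below_lt hv; rewrite ltn_neqAle => /andP[/negbTE->].
Qed.

(** * Merging derivations: soundness and completeness *)

Variable Y : nat.

(* [derives r y v]: in at most [r] merging rounds one obtains a connected
   multiset of vertices that contains [v] and, apart from [v], has total token
   value [y]; every intermediate value stays below [Y]. *)
Inductive derives : nat -> nat -> 'I_n -> Prop :=
  | derives0 r v : derives r 0 v
  | derivesS r y1 y2 u v :
      derives r y1 v -> derives r y2 u -> adj G u v ->
      y1 + y2 + token u < Y -> derives r.+1 (y1 + y2 + token u) v.

Lemma derives_mono r r' y v : r <= r' -> derives r y v -> derives r' y v.
Proof.
move=> rr' D; elim: D r' rr' => {r y v} [r v|r y1 y2 u v _ IH1 _ IH2 uv h] r' rr'.
  exact: derives0.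
case: r' rr' => // r' rr'.
by apply: derivesS uv h; [apply: IH1 | apply: IH2].
Qed.

Lemma derives_multiset r y v : derives r y v ->
  exists m : 'I_n -> nat,
    [/\ y + token v = \sum_x m x * token x, 0 < m v
      & induced_connected G [set x | 0 < m x]].
Proof.
elim=> [{r y v} _ v|{r y v} r y1 y2 u v _ [m1 [e1 p1 c1]] _ [m2 [e2 p2 c2]] uv _].
  exists (fun x => x == v); split; rewrite ?eqxx //.
    by rewrite (bigD1 v) //= eqxx mul1n big1 ?addn0 // => x /negbTE->.
  have -> : [set x | 0 < (x == v)] = [set v]; last exact: induced_connected1.
  by apply/setP => x; rewrite !inE lt0b.
exists (fun x => m1 x + m2 x); split; last 1 first.
- have -> : [set x | 0 < m1 x + m2 x] = [set x | 0 < m1 x] :|: [set x | 0 < m2 x].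
    by apply/setP => x; rewrite !inE addn_gt0.
  rewrite adj_sym in uv.
  by apply: induced_connectedU c1 c2 _ _ uv; rewrite inE.
- under eq_bigr => x _ do rewrite mulnDl.
  by rewrite big_split /= -e1 -e2; lia.
- by rewrite addn_gt0 p1.
Qed.

(** [J] counts nonterminals with multiplicity, so the support contains at most [J] of them, whatever
    overlaps occurred. *)
Lemma derives_yes r y v J k :
  (c + J).+1 * 2 ^ c <= Q -> J <= k ->
  derives r y v -> y + token v = target J -> steiner_yes G R k.
Proof.
move=> hQ Jk /derives_multiset[m [-> mv cm]] /(multiset_target hQ)[mr mJ].
apply/steiner_yesP; exists ([set x | 0 < m x] :|: R); split.
- apply: induced_connected_terminals => //.
  by apply/subsetP => r' /mr; rewrite inE.
- exact: subsetUr.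
apply: leq_trans Jk; rewrite setDUl setDv setU0 -mJ -sum1_card.
rewrite big_mkcond [X in _ <= X]big_mkcond /=; apply: leq_sum => x _.
by rewrite !inE; case: (x \in R); case: (posnP (m x)).
Qed.

(** [connected_split] yields two nonempty parts, both therefore smaller than [W]. Tokens are
    nonnegative, so the bound [Y] passes to the partial sums. *)
Lemma connected_derives r W v :
  induced_connected G W -> v \in W -> #|W| <= r.+1 ->
  \sum_(x in W :\ v) token x < Y -> derives r (\sum_(x in W :\ v) token x) v.
Proof.
elim: r W v => [|r IH] W v cW vW Wr hY.
  have -> : W :\ v = set0.
    by apply/eqP; rewrite -cards_eq0 -leqn0 -ltnS; move: Wr; rewrite (cardsD1 v W) vW.
  by rewrite big_set0; exact: derives0.
case: (set_0Vmem (W :\ v)) => [->|[z]]; first by rewrite big_set0; exact: derives0.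
rewrite !inE => /andP[zv zW].
have [W1 [W2 [u [eW dW [c1 v1] [c2 u2] vu]]]] := connected_split cW vW zW zv.
have v2 : v \notin W2 by rewrite (disjointFr dW v1).
have es : \sum_(x in W :\ v) token x =
    \sum_(x in W1 :\ v) token x + \sum_(x in W2 :\ u) token x + token u.
  rewrite -addnA (addnC _ (token u)).
  have <- : \sum_(x in W2) token x = token u + \sum_(x in W2 :\ u) token x.
    exact: big_setD1.
  rewrite -bigU /=; last by apply: disjointWl dW; exact: subsetDl.
  apply: eq_bigl => x; rewrite eW !inE; case: eqVneq => //= ->.
  by rewrite (negbTE v2).
have cc : #|W| = #|W1| + #|W2| by rewrite eW cardsU (disjoint_setI0 dW) cards0 subn0.
have W1p : 0 < #|W1| by apply/card_gt0P; exists v.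
have W2p : 0 < #|W2| by apply/card_gt0P; exists u.
rewrite es in hY *.
apply: derivesS => //; last by rewrite adj_sym.
- apply: IH => //; last by apply: leq_ltn_trans hY; rewrite -addnA leq_addr.
  by rewrite -ltnS; apply: leq_trans Wr; rewrite cc -[ltnLHS]addn0 ltn_add2l.
- apply: IH => //; last by apply: leq_ltn_trans hY; rewrite addnAC leq_addl.
  by rewrite -ltnS; apply: leq_trans Wr; rewrite cc -[ltnLHS]add0n ltn_add2r.
Qed.

Lemma yes_derives k :
  target k < Y -> steiner_yes G R k ->
  exists J y v, [/\ J <= k, derives n y v & y + token v = target J].
Proof.
move=> hY /steiner_yesP[W [cW RW Wk]].
have [/set0Pn[v vW] _] := cW.
have es : \sum_(x in W) token x = target #|W :\: R|.
  rewrite (big_setID R) /= (setIidPr RW) /target; congr (_ + _).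
    rewrite (big_setID reps) /= (setIidPr (representatives_sub G R)) [X in _ + X]big1 ?addn0 //.
    by move=> x; rewrite in_setD /token => /andP[/negbTE-> ->].
  rewrite -sum_nat_const; apply: eq_bigr => x.
  by rewrite in_setD /token => /andP[/negbTE->].
(* Any vertex of the solution may serve as [v]; a set of at most [n] vertices needs at most [n]
   rounds. *)
exists #|W :\: R|, (\sum_(x in W :\ v) token x), v; split=> //.
- apply: connected_derives => //; first by apply: leq_trans (max_card _) _; rewrite card_ord.
  apply: leq_ltn_trans hY; apply: leq_trans (_ : \sum_(x in W) token x <= _).
    by rewrite (big_setD1 v vW) leq_addl.
  by rewrite es leq_add2l leq_mul2r Wk orbT.
- by rewrite -es (big_setD1 v vW) addnC.
Qed.

End Tokens.

(** * The algorithm *)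

(** Arrays up to [a_adj] hold the input. [a_row] and [a_tab] hold the offsets u * n and v * Y of the
    rows of the adjacency matrix and of the table [a_mark]; [a_p] is the current power of two, [a_T]
    the sum of the tokens of the representatives. *)
Local Notation a_n := 0.
Local Notation a_k := 2.
Local Notation a_R := 3.
Local Notation a_adj := 4.
Local Notation a_row := 5.
Local Notation a_lab := 6.
Local Notation a_r := 7.
Local Notation a_u := 8.
Local Notation a_v := 9.
Local Notation a_p := 10.
Local Notation a_c := 11.
Local Notation a_T := 12.
Local Notation a_q := 13.
Local Notation a_len := 14.
Local Notation a_tok := 15.
Local Notation a_ans := 16.
Local Notation a_Y := 17.
Local Notation a_tab := 18.
Local Notation a_mark := 19.
Local Notation a_y1 := 20.
Local Notation a_y2 := 21.
Local Notation a_j := 22.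
Local Notation a_qp := 23.
Local Notation a_mulq := 24.
Local Notation a_k1 := 25.
Local Notation a_k25 := 26.

Definition set_scalar (a : nat) (e : expr) : stmt := Asg a (Const 0) e.

Definition scale (m : nat) (e : expr) : expr := iter m (Add e) (Const 0).

Definition when (e : expr) (P : stmt) : stmt := Cnd e P Nop.

(* For lack of multiplication, the multiples of a number are tabulated. *)
Definition multiples (i b a d : nat) : stmt :=
  Loop i b (Asg a (Add (scalar i) (Const 1)) (Add (Read a (scalar i)) (scalar d))).

Definition doubling (i b a : nat) : stmt :=
  Loop i b (set_scalar a (Add (scalar a) (scalar a))).

Lemma den_Sq P1 P2 s : den (Sq P1 P2) s = den P2 (den P1 s).
Proof. by []. Qed.

Lemma den_set_scalar a e s :
  den (set_scalar a e) s = mem_update s a 0 (eval s e).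
Proof. by []. Qed.

Lemma eval_scale s m e : eval s (scale m e) = m * eval s e.
Proof. by elim: m => //= m ->; rewrite mulSn. Qed.

Lemma den_multiples i b a d s :
  [/\ a != i, b != i, b != a, d != i & d != a] -> s a 0 = 0 ->
  forall j, j <= s b 0 -> den (multiples i b a d) s a j = j * s d 0.
Proof.
case=> ai bi ba di da a0.
pose I m (s1 : memory) := s1 d 0 = s d 0 /\ forall j, j <= m -> s1 a j = j * s d 0.
suff [] : I (s b 0) (den (multiples i b a d) s) by [].
apply: loop_ind; rewrite ?inE //; first by rewrite eq_sym.
- by rewrite eq_sym.
- split; first by rewrite upd_other.
  by move=> j; rewrite leqn0 => /eqP->; rewrite upd_other.
move=> m s1 _ im [Id Ia]; rewrite /incr /= !im.
split; first by rewrite !upd_other.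
move=> j jm; rewrite upd_other // updE eqxx /= addn1.
case: eqVneq => [->|jm']; first by rewrite Ia // Id mulSn addnC.
by apply: Ia; rewrite -ltnS ltn_neqAle jm' jm.
Qed.

Lemma den_doubling i b a s :
  [/\ a != i, b != i & b != a] ->
  den (doubling i b a) s a 0 = 2 ^ s b 0 * s a 0.
Proof.
case=> ai bi ba.
pose I m (s1 : memory) := s1 a 0 = 2 ^ m * s a 0.
suff : I (s b 0) (den (doubling i b a) s) by [].
apply: loop_ind; rewrite ?inE //; first by rewrite eq_sym.
- by rewrite eq_sym.
- by rewrite /I upd_other // expn0 mul1n.
move=> m s1 _ im Ia; rewrite /I /incr /= upd_other // upd_same Ia expnS; lia.
Qed.

Definition init_labels : stmt :=
  Loop a_v a_n (Asg a_lab (scalar a_v) (scalar a_v)).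

Definition relax_label : stmt :=
  when (Read a_R (scalar a_u)) (when (Read a_R (scalar a_v))
  (when (Read a_adj (Add (Read a_row (scalar a_u)) (scalar a_v)))
  (when (Defs.Sub (Read a_lab (scalar a_v)) (Read a_lab (scalar a_u)))
    (Asg a_lab (scalar a_v) (Read a_lab (scalar a_u)))))).

(** As in Bellman-Ford, [n] rounds suffice because a repetition-free path in G[R] has fewer than [n]
    edges. *)
Definition propagate_labels : stmt :=
  Loop a_r a_n (Loop a_u a_n (Loop a_v a_n relax_label)).

Definition component_phase : stmt :=
  Sq (set_scalar a_len (scale 51 (scalar a_k)))
  (Sq (set_scalar a_k25 (scale 25 (scalar a_k)))
  (Sq (set_scalar a_k1 (Add (scalar a_k) (Const 1)))
  (Sq (set_scalar a_q (Const 1))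
  (Sq (set_scalar a_p (Const 1))
  (Sq (multiples a_v a_n a_row a_n)
  (Sq init_labels propagate_labels)))))).

(** A label never exceeds its vertex, so for terminals the truncated difference vanishes exactly at
    the representatives. [a_p] doubles at each of them and ends as 2^c. *)
Definition number_representatives : stmt :=
  Loop a_v a_n (when (Read a_R (scalar a_v))
    (Cnd (Defs.Sub (scalar a_v) (Read a_lab (scalar a_v)))
      (Asg a_tok (scalar a_v) (Const 0))
      (Sq (Asg a_tok (scalar a_v) (Add (scalar a_q) (scalar a_p)))
      (Sq (set_scalar a_T (Add (scalar a_T) (Add (scalar a_q) (scalar a_p))))
      (Sq (set_scalar a_p (Add (scalar a_p) (scalar a_p)))
          (set_scalar a_c (Add (scalar a_c) (Const 1)))))))).

Definition nonterminal_tokens : stmt :=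
  Loop a_v a_n (Cnd (Read a_R (scalar a_v)) Nop
    (Asg a_tok (scalar a_v) (scalar a_qp))).

Definition token_phase : stmt :=
  Sq (doubling a_j a_len a_q)
  (Sq number_representatives
  (Sq (set_scalar a_qp (Add (scalar a_q) (scalar a_p)))
  (Sq nonterminal_tokens
  (Sq (multiples a_j a_k1 a_mulq a_qp)
      (set_scalar a_Y (Add (scalar a_T) (Read a_mulq (scalar a_k1)))))))).

Definition init_marks : stmt :=
  Loop a_v a_n (Asg a_mark (Read a_tab (scalar a_v)) (Const 1)).

Definition merge_marks : stmt :=
  when (Read a_mark (Add (Read a_tab (scalar a_v)) (scalar a_y1)))
  (when (Read a_mark (Add (Read a_tab (scalar a_u)) (scalar a_y2)))
  (when (Read a_adj (Add (Read a_row (scalar a_u)) (scalar a_v)))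
  (when (Defs.Sub (scalar a_Y)
           (Add (Add (scalar a_y1) (scalar a_y2)) (Read a_tok (scalar a_u))))
    (Asg a_mark
       (Add (Read a_tab (scalar a_v))
            (Add (Add (scalar a_y1) (scalar a_y2)) (Read a_tok (scalar a_u))))
       (Const 1))))).

Definition merge_round : stmt :=
  Loop a_y1 a_Y (Loop a_y2 a_Y (Loop a_u a_n (Loop a_v a_n merge_marks))).

(* The first test prevents the truncated subtraction in the second one from
   pointing at a wrong table entry. *)
Definition accept_vertex : stmt :=
  when (Defs.Sub (Add (Add (scalar a_T) (Read a_mulq (scalar a_j))) (Const 1))
          (Read a_tok (scalar a_v)))
  (when (Read a_mark (Add (Read a_tab (scalar a_v))
           (Defs.Sub (Add (scalar a_T) (Read a_mulq (scalar a_j)))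
                     (Read a_tok (scalar a_v)))))
     (set_scalar a_ans (Const 1))).

Definition accept : stmt := Loop a_j a_k1 (Loop a_v a_n accept_vertex).

Definition merge_phase : stmt :=
  Sq (multiples a_v a_n a_tab a_Y)
  (Sq init_marks (Sq (Loop a_r a_n merge_round) accept)).

(** [static] forbids a for-program to write its own loop bounds, hence the separate phases: the
    first computes [a_len] and [a_k1] for the second, which computes [a_Y] for the third. The test
    is placed between them because [a_Y] is known to be 2^O(k) only if c <= 25k. *)
Definition steiner_program : program :=
  Seq (compile component_phase)
  (Seq (compile token_phase)
  (Seq (If (Defs.Sub (scalar a_c) (scalar a_k25)) Skip (compile merge_phase))
       (Write 0 (Const 0) (scalar a_ans)))).

(** * Correctness *)

Section Correctness.
Variables (n : nat) (G : graph n) (R : {set 'I_n}).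
Implicit Types (u v w x : 'I_n) (s : memory).

Definition input_ok s : Prop :=
  [/\ s a_n 0 = n, forall v, s a_R v = (v \in R)
    & forall u v, s a_adj (u * n + v) = adj G u v].

Lemma input_frame P s :
  input_ok s -> [&& a_n \notin writes P, a_R \notin writes P & a_adj \notin writes P] ->
  input_ok (den P s).
Proof. by case=> h1 h2 h3 /and3P[w1 w2 w3]; split=> *; rewrite den_frame. Qed.

Lemma encode_ok t k : input_ok (encode G R t k).
Proof.
split=> //= [v|u v].
  congr nat_of_bool; apply/existsP/idP => [[u /andP[/eqP/val_inj-> //]]|vR].
  by exists v; rewrite eqxx.
congr nat_of_bool; apply/existsP/idP => [[u' /existsP[v' /andP[/eqP e h]]]|uv].
  have n0 : 0 < n by apply: leq_ltn_trans (ltn_ord u).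
  have eu : u = u'.
    by apply: val_inj; move: e => /(congr1 (divn^~ n)); rewrite !divnMDl // !divn_small ?addn0.
  have ev : v = v'.
    by apply: val_inj; move: e => /(congr1 (modn^~ n)); rewrite !modnMDl !modn_small.
  by rewrite eu ev.
by exists u; apply/existsP; exists v; rewrite eqxx.
Qed.

(** * Propagation of component labels *)

Section Labels.

Definition labels_ok s : Prop :=
  [/\ input_ok s, forall u, s a_row u = u * n
    & forall v, exists2 w : 'I_n, s a_lab v = w & connect (induced G R) v w].

(** The labels at the start of a round. Labels only decrease, so relaxing an edge out of [u] at any
    time during the round achieves at least [B u]. *)
Variable B : 'I_n -> nat.

Let I s := labels_ok s /\ forall v, s a_lab v <= B v.
Let le s s' := forall i, s' a_lab i <= s a_lab i.

Let le_trans s1 s2 s3 : le s1 s2 -> le s2 s3 -> le s1 s3.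
Proof. by move=> h1 h2 i; apply: leq_trans (h1 i). Qed.

Lemma relax_label_spec s u v :
  I s -> s a_u 0 = u -> s a_v 0 = v ->
  [/\ I (den relax_label s), le s (den relax_label s)
    & induced G R u v -> den relax_label s a_lab v <= B u].
Proof.
move=> Is su sv; have [[ok row lab] hB] := Is; have [hn hR hadj] := ok.
rewrite /= su sv !hR row hadj /induced.
case uR: (u \in R) => /=; last by split.
case vR: (v \in R) => /=; last by split.
case uv: (adj G u v) => /=; last by split.
case: eqVneq => [e|ne] /=.
  by split=> // _; apply: leq_trans (hB u); lia.
set s' := mem_update _ _ _ _.
have upd x : s' a_lab x = if x == v then s a_lab u else s a_lab x.
  by rewrite /s' updE.
split; last by rewrite upd eqxx.
  split; last by move=> x; rewrite upd; case: eqVneq => [->|//]; apply: leq_trans (hB v); lia.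
  split=> // x; rewrite upd; case: eqVneq => [->|_]; last exact: lab.
  have [w -> uw] := lab u; exists w => //; apply: connect_trans uw.
  by apply: connect1; rewrite /induced vR uR adj_sym.
by move=> i; rewrite /s' updE /=; case: eqVneq => [->|//]; lia.
Qed.

Lemma relax_round_spec s : I s ->
  [/\ I (den (Loop a_u a_n (Loop a_v a_n relax_label)) s),
      le s (den (Loop a_u a_n (Loop a_v a_n relax_label)) s)
    & forall u v, induced G R u v ->
        den (Loop a_u a_n (Loop a_v a_n relax_label)) s a_lab v <= B u].
Proof.
move=> Is; have nE s1 : I s1 -> s1 a_n 0 = n by case=> [[[]]].
pose g u s1 := forall v, induced G R u v -> s1 a_lab v <= B u.
pose g' j s1 := forall u, u = j :> nat -> g u s1.
have [|j s1 jn cj I1|I2 l2 h2] := @loop_all a_u a_n (Loop a_v a_n relax_label)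
  erefl erefl erefl I le g' s le_trans (fun _ _ _ => leqnn _) (fun _ _ h => h) _ Is.
- by move=> ? s1 s2 l h u uj v uv; apply: leq_trans (l v) _; apply: h.
- rewrite nE // in jn; pose u := Ordinal jn.
  pose J s := I s /\ s a_u 0 = u.
  pose f i s1 := forall v, v = i :> nat -> induced G R u v -> s1 a_lab v <= B u.
  have [|i s2 hi ci [I2 cu]|[I3 _] l3 h3] := @loop_all a_v a_n relax_label
    erefl erefl erefl J le f s1 le_trans (fun _ _ _ => leqnn _) (fun _ _ h => h) _ (conj I1 cj).
  + by move=> ? s2 s3 l h v vj uv; apply: leq_trans (l v) _; apply: h.
  + rewrite nE // in hi; have [I4 l4 h4] := relax_label_spec (v := Ordinal hi) I2 cu ci.
    split=> //; first by split=> //; rewrite den_frame.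
    by move=> v ev; have -> : v = Ordinal hi by apply: val_inj.
  split=> // u' eu v; have -> : u' = u by apply: val_inj.
  by move=> uv; apply: (h3 v) => //; rewrite nE.
split=> // u v; apply: (h2 u _ u) => //; by rewrite nE.
Qed.

End Labels.

Lemma propagate_labels_spec s :
  labels_ok s -> (forall v, s a_lab v <= v) ->
  labels_ok (den propagate_labels s) /\
  forall v, v \in R ->
    (den propagate_labels s a_lab v == v) = (v \in representatives G R) /\
    den propagate_labels s a_lab v <= v.
Proof.
move=> ok lab0.
pose I r s1 := labels_ok s1 /\ forall v w p,
  path (induced G R) w p -> last w p = v -> size p <= r -> s1 a_lab v <= w.
have [ok' lab'] : I n (den propagate_labels s).
  have sn : s a_n 0 = n by case: ok => [[]].
  rewrite -{1}sn; apply: loop_ind => //.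
    split; first exact: ok.
    by move=> v w [] //= _ -> _; apply: lab0.
  move=> r s1 _ _ [ok1 h1].
  have [[ok2 hB] l2 h2] := relax_round_spec (B := fun v => s1 a_lab v) (conj ok1 (fun v => leqnn _)).
  split; first exact: ok2.
  move=> v w p; case/lastP: p => [|p y].
    move=> _ /= -> _; apply: leq_trans (hB v) _; exact: (h1 v v [::]).
  rewrite rcons_path last_rcons size_rcons ltnS => /andP[hp ly] <- sp.
  apply: leq_trans (h2 _ _ ly) _; exact: h1 hp erefl sp.
split=> // v vR.
have low u : connect (induced G R) v u -> den propagate_labels s a_lab v <= u.
  rewrite (sym_connect_sym (@induced_sym _ G R)) => /connectP[p0 hp0 ev].
  case/shortenP: hp0 ev => p hp up _ ev; apply: lab' hp (esym ev) _.
  by have := max_card [in u :: p]; rewrite (card_uniqP up) card_ord; apply: ltnW.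
have [w lw vw] : exists2 w : 'I_n, den propagate_labels s a_lab v = w & connect (induced G R) v w.
  by case: ok'.
split; last by apply: low; exact: connect0.
rewrite inE vR; apply/eqP/forallP => [e u|h].
  by apply/implyP => /low; rewrite e.
apply/eqP; rewrite eqn_leq low ?connect0 // lw.
by have := h w; rewrite vw.
Qed.

Lemma init_labels_spec s : s a_n 0 = n ->
  forall v, den init_labels s a_lab v = v.
Proof.
move=> sn v.
pose I m s1 := forall j, j < m -> s1 a_lab j = j.
suff: I n (den init_labels s) by apply.
rewrite -{1}sn; apply: loop_ind => // m s1 _ cm Im j.
rewrite /incr upd_other //= cm updE eqxx /= ltnS.
by rewrite leq_eqVlt; case: eqVneq => //= _; apply: Im.
Qed.

Definition component_phase_ok k s : Prop :=
  [/\ input_ok s, forall u, s a_row u = u * n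
    & forall v, v \in R -> (s a_lab v == v) = (v \in representatives G R) /\ s a_lab v <= v] /\
  [/\ s a_len 0 = 51 * k, s a_k25 0 = 25 * k, s a_k1 0 = k.+1, s a_q 0 = 1 & s a_p 0 = 1] /\
  [/\ s a_T 0 = 0, s a_c 0 = 0, s a_mulq 0 = 0, s a_tab 0 = 0 & s a_ans 0 = 0].

Lemma component_phase_spec t k : component_phase_ok k (den component_phase (encode G R t k)).
Proof.
rewrite /component_phase !(den_Sq, den_set_scalar) !eval_scale.
set s1 := mem_update _ a_p 0 _.
set s2 := den (multiples _ _ _ _) s1.
set s3 := den init_labels s2.
have i1 : input_ok s1 := encode_ok t k.
have i2 : input_ok s2 by apply: input_frame i1 _.
have n1 : s1 a_n 0 = n by case: i1.
have n2 : s2 a_n 0 = n by case: i2.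
have lab3 := init_labels_spec n2.
have ok3 : labels_ok s3.
  split; first exact: input_frame i2 _.
  - move=> u; rewrite /s3 den_frame // /s2 den_multiples // n1 //; exact: ltnW.
  - by move=> v; exists v; [exact: lab3 | exact: connect0].
have [|ok4 lab4] := propagate_labels_spec ok3; first by move=> v; rewrite /s3 lab3.
split; first by case: ok4.
by split; split; rewrite den_frame // /s3 den_frame // /s2 den_frame // /s1 /= ?addn1.
Qed.

(** * Computation of the tokens and of the table width *)

Section TokenPhase.
Variable Q : nat.

Let reps := representatives G R.
Let c := #|reps|.

Lemma rank_belowS v :
  rank_below G R v.+1 = rank_below G R v + (v \in reps).
Proof.
rewrite /rank_below (cardsD1 v) in_set ltnSn andbT addnC; congr (_ + _).
apply: eq_card => x; rewrite !in_set in_set1 ltnS (leq_eqVlt x).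
have -> : (val x == val v) = (x == v) by [].
by case: eqVneq => [->|]; rewrite ?ltnn ?andbF.
Qed.

Lemma rank_below_all : rank_below G R n = c.
Proof. by apply: eq_card => x; rewrite in_set ltn_ord andbT. Qed.

Lemma number_representatives_spec s :
  input_ok s ->
  (forall v, v \in R -> (s a_lab v == v) = (v \in reps) /\ s a_lab v <= v) ->
  [/\ s a_T 0 = 0, s a_c 0 = 0, s a_q 0 = Q & s a_p 0 = 1] ->
  let s' := den number_representatives s in
  [/\ s' a_p 0 = 2 ^ c, s' a_c 0 = c, s' a_T 0 = target G R Q 0
    & forall v, v \in R -> s' a_tok v = token G R Q v].
Proof.
move=> ok lab [T0 c0 q0 p0] s'.
pose I m s1 := [/\ input_ok s1, s1 a_q 0 = Q &
    (forall v, v \in R -> (s1 a_lab v == v) = (v \in reps) /\ s1 a_lab v <= v)] /\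
  [/\ s1 a_p 0 = 2 ^ rank_below G R m, s1 a_c 0 = rank_below G R m,
       s1 a_T 0 = \sum_(v in reps | v < m) token G R Q v
     & forall v, v < m -> v \in R -> s1 a_tok v = token G R Q v].
have nE : s a_n 0 = n by case: ok.
have [_] : I n s'.
  rewrite -{1}nE; apply: loop_ind => //.
    have r0 : rank_below G R 0 = 0 by apply: eq_card0 => x; rewrite in_set andbF.
    split; [by [] | split=> //].
    - by rewrite r0.
    - by rewrite r0.
    - by rewrite big_pred0 // => x; rewrite andbF.
  move=> m s1 hm cm [[ok1 q1 lab1] [p1 c1 T1 tok1]].
  rewrite nE in hm; have [v ev] : exists v : 'I_n, v = m :> nat by exists (Ordinal hm).
  move: cm p1 c1 T1 tok1; rewrite -{m hm}ev => cv p1 c1 T1 tok1.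
  have [_ hR _] := ok1.
  have sumS : \sum_(x in reps | x < v.+1) token G R Q x =
      \sum_(x in reps | x < v) token G R Q x +
      (if v \in reps then token G R Q v else 0).
    rewrite big_mkcondr [in RHS]big_mkcondr /=.
    case: ifP => vr.
      rewrite (bigD1 v) //= ltnSn [in RHS](bigD1 v) //= ltnn add0n addnC; congr (_ + _).
      apply: eq_bigr => x /andP[_ xv]; rewrite ltnS leq_eqVlt.
      by have -> : (x == v :> nat) = (x == v) by []; rewrite (negbTE xv).
    rewrite addn0; apply: eq_bigr => x xr; rewrite ltnS leq_eqVlt.
    have -> : (x == v :> nat) = (x == v) by [].
    by case: eqVneq => // xv; rewrite -xv xr in vr.
  have subv x : x < v.+1 -> x = v \/ x < v.
    rewrite ltnS leq_eqVlt => /orP[/eqP e|]; [left; exact: val_inj | by right].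
  rewrite /I /incr [den _ s1]/= cv hR sumS rank_belowS.
  have subR : v \in reps -> v \in R by apply: (subsetP (representatives_sub G R)).
  case vR: (v \in R) => /=; last first.
    have vr : (v \in reps) = false by apply: contraFF vR.
    rewrite vr !addn0; split; first by [].
    by split=> // x /subv[->|]; [rewrite vR | apply: tok1].
  have [elab llab] := lab1 v vR.
  have -> : (v - s1 a_lab v != 0) = (v \notin reps) by rewrite -elab; lia.
  case vr: (v \in reps) => /=.
    have tv : token G R Q v = Q + 2 ^ rank_below G R v by rewrite /token vR vr.
    split; first by [].
    split.
    - by rewrite !updE /= p1 addn1 expnS; lia.
    - by rewrite !updE /= c1.
    - by rewrite !updE /= T1 q1 p1 tv.
    - move=> x /subv[->|xv] xR; first by rewrite !updE /= eqxx q1 p1 tv.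
      by rewrite !updE /= (ltn_eqF xv) tok1.
  rewrite !addn0; split; first by [].
  split=> // x /subv[->|xv] xR; first by rewrite !updE /= eqxx /token vR vr.
  by rewrite !updE /= (ltn_eqF xv) tok1.
rewrite rank_below_all; case=> -> -> -> tok; split=> //.
- by rewrite /target mul0n addn0; apply: eq_bigl => x; rewrite ltn_ord andbT.
- by move=> v; apply: tok.
Qed.

Lemma nonterminal_tokens_spec s :
  input_ok s -> s a_qp 0 = Q + 2 ^ c ->
  (forall v, v \in R -> s a_tok v = token G R Q v) ->
  forall v, den nonterminal_tokens s a_tok v = token G R Q v.
Proof.
move=> ok hqp tokR w.
pose I m s1 := [/\ input_ok s1, s1 a_qp 0 = Q + 2 ^ c &
  forall v, (v < m) || (v \in R) -> s1 a_tok v = token G R Q v].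
have nE : s a_n 0 = n by case: ok.
suff [_ _ H] : I n (den nonterminal_tokens s) by apply: H; rewrite ltn_ord.
rewrite -{1}nE; apply: loop_ind => // m s1 hm cm [ok1 qp1 tok1].
rewrite nE in hm; have [v ev] : exists v : 'I_n, v = m :> nat by exists (Ordinal hm).
move: cm tok1; rewrite -{m hm}ev => cv tok1; have [_ hR _] := ok1.
have subv x : x < v.+1 -> x = v \/ x < v.
  rewrite ltnS leq_eqVlt => /orP[/eqP e|]; [left; exact: val_inj | by right].
rewrite /I /incr [den _ s1]/= cv hR; case vR: (v \in R) => /=.
  split=> // x /orP[/subv[->|xv]|xR]; apply: tok1; rewrite ?vR ?xv ?xR ?orbT //.
split=> // x hx; rewrite !updE /=; case: eqVneq => [/val_inj->|xv].
  by rewrite qp1 /token vR.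
case/orP: hx => [/subv[xv'|xv']|xR]; first by rewrite xv' eqxx in xv.
  by rewrite tok1 ?xv'.
by rewrite tok1 ?xR ?orbT.
Qed.

End TokenPhase.

Definition token_phase_ok k Q s : Prop :=
  let c := #|representatives G R| in
  [/\ input_ok s, forall u, s a_row u = u * n,
       forall v, s a_tok v = token G R Q v & s a_Y 0 = target G R Q k.+1] /\
  [/\ s a_T 0 = target G R Q 0, forall j, j <= k.+1 -> s a_mulq j = j * (Q + 2 ^ c),
       s a_c 0 = c, s a_k25 0 = 25 * k & s a_k1 0 = k.+1] /\
  [/\ s a_tab 0 = 0 & s a_ans 0 = 0].

Lemma token_phase_spec k s : component_phase_ok k s -> token_phase_ok k (2 ^ (51 * k)) (den token_phase s).
Proof.
move=> [[i0 row0 lab0] [[len0 k250 k10 q0 p0] [T0 c0 mq0 tab0 ans0]]].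
set Q := 2 ^ _; set c := #|representatives G R|.
rewrite /token_phase !(den_Sq, den_set_scalar).
set s1 := den (doubling _ _ _) s.
set s2 := den number_representatives s1.
set s3 := mem_update s2 a_qp 0 _.
set s4 := den nonterminal_tokens s3.
set s5 := den (multiples _ _ _ _) s4.
have i1 : input_ok s1 by apply: input_frame i0 _.
have i2 : input_ok s2 by apply: input_frame i1 _.
have i3 : input_ok s3 := i2.
have i4 : input_ok s4 by apply: input_frame i3 _.
have i5 : input_ok s5 by apply: input_frame i4 _.
have q1 : s1 a_q 0 = Q by rewrite /s1 den_doubling // len0 q0 muln1.
have [||p2 c2 T2 tok2] := @number_representatives_spec Q s1 i1.
- by move=> v vR; rewrite /s1 den_frame //; apply: lab0.
- by split=> //; rewrite /s1 den_frame.
have qp3 : s3 a_qp 0 = Q + 2 ^ c.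
  by rewrite /s3 upd_same /= /s2 p2 den_frame // q1.
have tok4 : forall v, s4 a_tok v = token G R Q v.
  by apply: nonterminal_tokens_spec qp3 _ => // v vR; rewrite /s3 upd_other // tok2.
have qp4 : s4 a_qp 0 = Q + 2 ^ c by rewrite /s4 den_frame.
have k14 : s4 a_k1 0 = k.+1.
  by rewrite /s4 den_frame // /s3 upd_other // /s2 den_frame // /s1 den_frame.
have mq5 j : j <= k.+1 -> s5 a_mulq j = j * (Q + 2 ^ c).
  move=> hj; rewrite /s5 den_multiples ?qp4 ?k14 //.
  by rewrite /s4 den_frame // /s3 upd_other // /s2 den_frame // /s1 den_frame.
have T5 : s5 a_T 0 = target G R Q 0.
  by rewrite /s5 den_frame // /s4 den_frame // /s3 upd_other.
have k15 : s5 a_k1 0 = k.+1 by rewrite /s5 den_frame.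
split; first split.
- exact: i5.
- move=> u; rewrite upd_other // /s5 den_frame // /s4 den_frame // /s3 upd_other //.
  by rewrite /s2 den_frame // /s1 den_frame.
- by move=> v; rewrite upd_other // /s5 den_frame.
- by rewrite upd_same /= T5 k15 mq5 // /target mul0n addn0.
split; split; rewrite ?upd_other //.
- by rewrite /s5 den_frame // /s4 den_frame // /s3 upd_other.
- by rewrite /s5 den_frame // /s4 den_frame // /s3 upd_other // /s2 den_frame // /s1 den_frame.
- by rewrite /s5 den_frame // /s4 den_frame // /s3 upd_other // /s2 den_frame // /s1 den_frame.
- by rewrite /s5 den_frame // /s4 den_frame // /s3 upd_other // /s2 den_frame // /s1 den_frame.
Qed.

(** * The table of attainable sums *)

Section MergePhase.
Variables (k Q Y : nat).

Let c := #|representatives G R|.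
Let tok := token G R Q.
Let marked s y v := s a_mark (v * Y + y) != 0.

(** Marks are updated in place, so a round may combine marks that it has just set. Soundness
    therefore leaves the number of rounds open; only completeness counts them. *)
Definition marks_ok s : Prop :=
  [/\ input_ok s, forall u, s a_row u = u * n, forall v, s a_tok v = tok v
     & s a_Y 0 = Y] /\
  [/\ forall v, s a_tab v = v * Y
     & forall v y, y < Y -> marked s y v -> exists r, derives G R Q Y r y v].

Let le s s' := forall i, s a_mark i != 0 -> s' a_mark i != 0.

Let le_trans s1 s2 s3 : le s1 s2 -> le s2 s3 -> le s1 s3.
Proof. by move=> h1 h2 i /h1 /h2. Qed.

Section Round.
(** Entries known to be marked when the round starts; marks are never erased, so these stay
    available throughout it. *)
Variable X : nat -> 'I_n -> Prop.

Let I s := marks_ok s /\ forall y v, X y v -> marked s y v.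
Let goal y1 y2 u v s := X y1 v -> X y2 u -> adj G u v -> y1 + y2 + tok u < Y ->
  marked s (y1 + y2 + tok u) v.

Let goal_mono y1 y2 u v s s' : le s s' -> goal y1 y2 u v s -> goal y1 y2 u v s'.
Proof. by move=> l h h1 h2 h3 h4; apply: l; apply: h. Qed.

Let I_Y s : I s -> s a_Y 0 = Y.
Proof. by case=> [[[]]]. Qed.

Let I_n s : I s -> s a_n 0 = n.
Proof. by case=> [[[[]]]]. Qed.

Lemma merge_marks_spec s y1 y2 u v :
  I s -> y1 < Y -> y2 < Y ->
  [/\ s a_y1 0 = y1, s a_y2 0 = y2, s a_u 0 = u & s a_v 0 = v] ->
  [/\ I (den merge_marks s), le s (den merge_marks s)
    & goal y1 y2 u v (den merge_marks s)].
Proof.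
move=> Is y1Y y2Y [c1 c2 cu cv].
have [[[inp row tk sY] [tab snd]] hX] := Is; have [_ _ hadj] := inp.
rewrite /= c1 c2 cu cv !tab row hadj tk sY.
case: (boolP (s a_mark (v * Y + y1) != 0)) => [m1|/negbTE n1]; last first.
  by split=> // /hX; rewrite /marked n1.
case: (boolP (s a_mark (u * Y + y2) != 0)) => [m2|/negbTE n2]; last first.
  by split=> // _ /hX; rewrite /marked n2.
case uv: (adj G u v) => /=; last by split=> // _ _; rewrite uv.
rewrite subn_eq0 -ltnNge; case: ltnP => [lt|ge]; last first.
  by split=> // _ _ _; rewrite ltnNge ge.
set s' := mem_update _ _ _ _.
have ss' : le s s' by move=> i; rewrite /s' updE /=; case: ifP.
split; [split; last by move=> y w /hX; apply: ss'| exact: ss'|]; last first.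
  by rewrite /goal /marked /s' upd_same.
split; [by [] | split=> // w y hy].
rewrite /marked /s' updE eqxx /=.
(* Both values are below [Y], so equal cells mean equal rows and equal values. *)
case: (eqVneq (w * Y + y) (v * Y + (y1 + y2 + tok u))) => [e _|_]; last exact: snd.
have Y0 : 0 < Y by apply: leq_ltn_trans hy.
have ey : y = y1 + y2 + tok u.
  by move: e => /(congr1 (modn^~ Y)); rewrite !modnMDl !modn_small.
have ew : w = v.
  by apply: val_inj; move: e => /(congr1 (divn^~ Y)); rewrite !divnMDl // !divn_small ?addn0.
have [r1 d1] := snd v y1 y1Y m1; have [r2 d2] := snd u y2 y2Y m2.
exists (maxn r1 r2).+1; rewrite ey ew; apply: derivesS => //.
- by apply: derives_mono d1; rewrite leq_maxl.
- by apply: derives_mono d2; rewrite leq_maxr.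
Qed.

Lemma merge_round_spec s : I s ->
  [/\ I (den merge_round s), le s (den merge_round s)
    & forall y1 y2 u v, y1 < Y -> y2 < Y -> goal y1 y2 u v (den merge_round s)].
Proof.
move=> Is.
pose g1 y1 s1 := forall y2 u v, y2 < Y -> goal y1 y2 u v s1.
have [|y1 s1 h1 cy1 I1|I' l' H] := @loop_all a_y1 a_Y
  (Loop a_y2 a_Y (Loop a_u a_n (Loop a_v a_n merge_marks)))
  erefl erefl erefl I le g1 s le_trans (fun _ _ _ h => h) (fun _ _ h => h) _ Is; last first.
- split=> // y1 y2 u v h1 h2; apply: H => //; by rewrite I_Y.
- rewrite I_Y // in h1.
  (* The invariants of the inner loops also remember the outer counters. *)
  pose J1 s := I s /\ s a_y1 0 = y1.
  pose g2 y2 s1 := forall u v, goal y1 y2 u v s1.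
  have [|y2 s2 h2 cy2 [I2 c2]|[I' _] l' H] := @loop_all a_y2 a_Y
    (Loop a_u a_n (Loop a_v a_n merge_marks))
    erefl erefl erefl J1 le g2 s1 le_trans (fun _ _ _ h => h) (fun _ _ h => h) _ (conj I1 cy1); last first.
  + split=> // y2 u v h2; apply: H; by rewrite I_Y.
  + rewrite I_Y // in h2.
    pose J2 s := I s /\ (s a_y1 0 = y1 /\ s a_y2 0 = y2).
    pose g3 i s1 := forall u v, u = i :> nat -> goal y1 y2 u v s1.
    have [|i s3 h3 cu [I3 c3]|[I' [E _]] l' H] := @loop_all a_u a_n (Loop a_v a_n merge_marks)
      erefl erefl erefl J2 le g3 s2 le_trans (fun _ _ _ h => h) (fun _ _ h => h) _ (conj I2 (conj c2 cy2)); last first.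
    * split=> // u v; apply: H (erefl); by rewrite I_n.
    * rewrite I_n // in h3; pose u := Ordinal h3.
      pose J3 s := I s /\ [/\ s a_y1 0 = y1, s a_y2 0 = y2 & s a_u 0 = u].
      pose g4 j s1 := forall v, v = j :> nat -> goal y1 y2 u v s1.
      have [|j s4 h4 cv [I4 [d1 d2 d3]]|[I' [E1 E2 _]] l' H] := @loop_all a_v a_n merge_marks
        erefl erefl erefl J3 le g4 s3 le_trans (fun _ _ _ h => h) (fun _ _ h => h) _
        (conj I3 (And3 c3.1 c3.2 cu)); last first.
      -- split=> // u' v eu; have -> : u' = u by apply: val_inj.
         by apply: H (erefl); rewrite I_n.
      -- rewrite I_n // in h4; pose v := Ordinal h4.
         have [I5 l5 G5] := merge_marks_spec I4 h1 h2 (And4 d1 d2 d3 (cv : s4 a_v 0 = v)).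
         split=> //; last by move=> v' ev; have -> : v' = v by apply: val_inj.
         by split=> //; split; rewrite den_frame.
      by move=> ? s4 s5 l h v ev; apply: goal_mono l (h v ev).
    by move=> ? s3 s4 l h u v eu; apply: goal_mono l (h u v eu).
  by move=> ? s2 s3 l h u v; apply: goal_mono l (h u v).
by move=> ? s1 s2 l h y2 u v hy; apply: goal_mono l (h y2 u v hy).
Qed.

End Round.

Lemma rounds_spec s :
  marks_ok s -> (forall v, marked s 0 v) ->
  marks_ok (den (Loop a_r a_n merge_round) s) /\
  forall y v, y < Y -> derives G R Q Y n y v ->
    marked (den (Loop a_r a_n merge_round) s) y v.
Proof.
move=> ok m0; have sn : s a_n 0 = n by case: ok => [[[]]].
pose I r s1 := marks_ok s1 /\
  forall y v, y < Y -> derives G R Q Y r y v -> marked s1 y v.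
suff : I n (den (Loop a_r a_n merge_round) s) by [].
rewrite -{1}sn; apply: loop_ind => //.
  split; first exact: ok.
  by move=> y v _ d; inversion d; apply: m0.
move=> r s1 _ _ [ok1 h1].
pose X y v := y < Y /\ derives G R Q Y r y v.
have X1 y v : X y v -> marked s1 y v by case; apply: h1.
have [[ok2 hX] _ h2] := merge_round_spec (conj ok1 X1).
split; first exact: ok2.
move=> y v hy d; inversion d as [|r' y1 y2 u v' d1 d2 uv hs]; subst.
  by apply: hX; split; last exact: derives0.
have l1 : y1 < Y by apply: leq_ltn_trans hy; rewrite -addnA leq_addr.
have l2 : y2 < Y by apply: leq_ltn_trans hy; rewrite addnAC leq_addl.
by apply: h2.
Qed.

(** The target for k + 1 nonterminals lies strictly above those for J <= k, so every sum to be
    tested fits into a row of the table. *)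
Hypothesis Y_target : Y = target G R Q k.+1.
Hypothesis Q_large : forall J, J <= k -> (c + J).+1 * 2 ^ c <= Q.

Let targetE J : target G R Q J = target G R Q 0 + J * (Q + 2 ^ c).
Proof. by rewrite /target mul0n addn0. Qed.

Let target_lt J : J <= k -> target G R Q J < Y.
Proof.
move=> Jk; rewrite Y_target targetE [ltnRHS]targetE ltn_add2l ltn_mul2r ltnS Jk andbT.
by rewrite addn_gt0 expn_gt0 orbT.
Qed.

Lemma init_marks_spec s :
  [/\ input_ok s, forall u, s a_row u = u * n, forall v, s a_tok v = tok v
     & s a_Y 0 = Y] ->
  (forall v, s a_tab v = v * Y) -> (forall i, s a_mark i = 0) ->
  marks_ok (den init_marks s) /\ forall v, marked (den init_marks s) 0 v.
Proof.
move=> ok tab m0; have nE : s a_n 0 = n by case: ok => [[]].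
have Y0 : 0 < Y by apply: leq_ltn_trans (target_lt (leq0n k)).
pose I m s1 := [/\ input_ok s1, forall u, s1 a_row u = u * n, forall v, s1 a_tok v = tok v
     & s1 a_Y 0 = Y] /\ [/\ forall v, s1 a_tab v = v * Y,
  forall v y, y < Y -> marked s1 y v -> y = 0 & forall v, v < m -> marked s1 0 v].
have [ok' [tab' snd' cpl']] : I n (den init_marks s).
  rewrite -{1}nE; apply: loop_ind => //.
    by split=> //; split=> // v y _; rewrite /marked upd_other // m0.
  move=> m s1 hm cm [ok1 [tab1 snd1 cpl1]].
  rewrite nE in hm; have [v ev] : exists v : 'I_n, v = m :> nat by exists (Ordinal hm).
  move: cm cpl1; rewrite -{m hm}ev => cv cpl1.
  have subv x : x < v.+1 -> x = v \/ x < v.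
    rewrite ltnS leq_eqVlt => /orP[/eqP e|]; [left; exact: val_inj | by right].
  rewrite /I /marked /incr [den _ s1]/= cv tab1; split; first by [].
  split=> //.
  + move=> w y hy; rewrite !updE /=; case: (eqVneq (w * Y + y) (v * Y)) => [e _|_]; last exact: snd1.
    by move: e => /(congr1 (modn^~ Y)); rewrite modnMDl modnMl modn_small.
  + move=> w /subv[->|hw]; first by rewrite !updE /= addn0 eqxx.
    by rewrite !updE /=; case: ifP => // _; apply: cpl1.
split; last by move=> v; apply: cpl'.
split=> //; split=> // v y hy /(snd' v y hy) ->; exists 0; exact: derives0.
Qed.

Let A s := [/\ marks_ok s, forall y v, y < Y -> derives G R Q Y n y v -> marked s y v,
    s a_T 0 = target G R Q 0, forall j, j <= k.+1 -> s a_mulq j = j * (Q + 2 ^ c)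
  & s a_k1 0 = k.+1] /\
  (s a_ans 0 <= 1 /\ (s a_ans 0 != 0 -> steiner_yes G R k)).

Lemma accept_spec s : A s ->
  den accept s a_ans 0 <= 1 /\ (den accept s a_ans 0 != 0 <-> steiner_yes G R k).
Proof.
move=> As.
have An s1 : A s1 -> s1 a_n 0 = n by case=> [[[[[]]]]].
have Ak s1 : A s1 -> s1 a_k1 0 = k.+1 by case=> [[]].
pose ls s1 s2 := s1 a_ans 0 != 0 -> s2 a_ans 0 != 0.
have ls_trans s1 s2 s3 : ls s1 s2 -> ls s2 s3 -> ls s1 s3 by move=> h1 h2 /h1 /h2.
pose g J s1 := forall v y, derives G R Q Y n y v -> y + tok v = target G R Q J -> s1 a_ans 0 != 0.
have [|J s1 hJ cJ A1|A' _ H] := @loop_all a_j a_k1 (Loop a_v a_n accept_vertex) erefl erefl erefl A ls g s ls_trans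
  (fun _ _ h => h) (fun _ _ h => h) _ As; last first.
- case: A' => _ [le1 snd]; split=> //; split=> // yes.
  have [J [y [v [Jk d e]]]] := yes_derives (target_lt (leqnn k)) yes.
  by apply: (H J _ v y d e); rewrite Ak.
- rewrite Ak // ltnS in hJ.
  pose A2 s := A s /\ s a_j 0 = J.
  pose g2 i s1 := forall v y, v = i :> nat -> derives G R Q Y n y v ->
    y + tok v = target G R Q J -> s1 a_ans 0 != 0.
  have [|i s2 hi cv [As2 c2]|[A' _] l' H] := @loop_all a_v a_n accept_vertex erefl erefl erefl A2 ls g2 s1 ls_trans
    (fun _ _ h => h) (fun _ _ h => h) _ (conj A1 cJ); last first.
  + split=> // v y; apply: (H v) => //; by rewrite An.
  + rewrite An // in hi; have [v ev] : exists v : 'I_n, v = i :> nat by exists (Ordinal hi).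
    rewrite -{i hi}ev in cv *.
    have [[mk cpl T2 mq2 _] [le1 yes2]] := As2.
    have [[_ _ tk2 Y2] [tab2 snd2]] := mk.
    have eJ : s2 a_T 0 + s2 a_mulq J = target G R Q J.
      by rewrite T2 mq2 ?(leq_trans hJ) // -targetE.
    have -> : den accept_vertex s2 =
        if target G R Q J + 1 - tok v != 0 then
          if marked s2 (target G R Q J - tok v) v then mem_update s2 a_ans 0 1 else s2
        else s2.
      by rewrite /= cv c2 eJ tk2 tab2.
    (* If the token of [v] exceeds the target, no sum that includes it can equal the target. *)
    rewrite addn1 subn_eq0 -ltnNge ltnS; case: leqP => [tle|tgt]; last first.
      split=> // w y /val_inj-> _ e.
      by move: tgt; rewrite -e ltnNge leq_addl.
    have yY : target G R Q J - tok v < Y.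
      by apply: leq_ltn_trans (target_lt hJ); rewrite leq_subr.
    case: (boolP (marked _ _ _)) => [mk2|nm].
      split=> //; split=> //; split; first by case: As2.
      split=> // _; have [r d] := snd2 v _ yY mk2.
      by apply: derives_yes (Q_large hJ) hJ d _; rewrite subnK.
    split=> // w y /val_inj-> d e; case/negP: nm.
    have ey : target G R Q J - tok v = y by rewrite -e addnK.
    by rewrite ey in yY *; apply: cpl.
  by move=> ? s2 s3 l h v y ei d e; apply: l; apply: h ei d e.
by move=> ? s1 s2 l h v y d e; apply: l; apply: h d e.
Qed.

Lemma merge_phase_spec s :
  token_phase_ok k Q s -> (forall i, s a_mark i = 0) ->
  den merge_phase s a_ans 0 <= 1 /\ (den merge_phase s a_ans 0 != 0 <-> steiner_yes G R k).
Proof.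
move=> [[i0 row0 tok0 Y0] [[T0 mq0 c0 k250 k10] [tab0 ans0]]] m0.
rewrite -Y_target in Y0.
rewrite /merge_phase !den_Sq.
set s1 := den (multiples _ _ _ _) s.
set s2 := den init_marks s1.
set s3 := den (Loop a_r a_n merge_round) s2.
have n0 : s a_n 0 = n by case: i0.
have [||| mk2 z2] := @init_marks_spec s1.
- split; first exact: input_frame i0 _.
  + by move=> u; rewrite /s1 den_frame.
  + by move=> v; rewrite /s1 den_frame // tok0.
  + by rewrite /s1 den_frame.
- by move=> v; rewrite /s1 den_multiples ?Y0 // n0 ltnW.
- by move=> i; rewrite /s1 den_frame.
have [mk3 cpl3] := rounds_spec mk2 z2.
have fr a j : [&& a != a_v, a != a_tab, a != a_mark, a != a_r, a != a_u, a != a_y1 & a != a_y2] ->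
    s3 a j = s a j.
  move=> /and5P[? ? ? ? /and3P[? ? ?]].
  by rewrite /s3 den_frame ?inE ?negb_or; [rewrite /s2 den_frame ?inE ?negb_or; [rewrite /s1 den_frame ?inE ?negb_or|]|]; do ?[apply/andP; split] => //=.
apply: accept_spec; split; last by rewrite fr // ans0.
split=> //.
- by rewrite fr.
- by move=> j hj; rewrite fr // mq0.
- by rewrite fr.
Qed.

End MergePhase.

End Correctness.
(** * Running time *)

Lemma computable_exp2 a : computable (fun k => 2 ^ (a * k)).
Proof.
pose P1 := Sq (set_scalar 1 (scale a (scalar 0))) (set_scalar 2 (Const 1)).
pose P2 := doubling 3 1 2.
exists (Seq (compile P1) (Seq (compile P2) (Write 0 (Const 0) (scalar 2)))) => x.
set s := mem_update _ 0 0 x.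
have [//|//|t1 h1 _] := @exec_den P1 s 0.
have [//|b|t2 h2 _] := @exec_den P2 (den P1 s) (a * x).
  rewrite inE => /eqP->.
  by rewrite /P1 den_Sq !den_set_scalar eval_scale.
eexists; eexists; split; first exact: exec_seq h1 (exec_seq h2 (exec_write _ _ _ _)).
rewrite /output upd_same -[eval _ _]/(den P2 (den P1 s) 2 0) den_doubling //.
by rewrite /P1 den_Sq !den_set_scalar eval_scale /= muln1.
Qed.

Lemma linear_le_exp2 a b k : 0 < k -> a <= 2 ^ b -> a * k <= 2 ^ (b.+1 * k).
Proof.
move=> k0 ab; rewrite mulSn addnC expnD.
apply: leq_mul; last by apply: ltnW; apply: ltn_expl.
by apply: leq_trans ab _; rewrite leq_pexp2l // leq_pmulr.
Qed.

Section Bounds.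
Variables (n : nat) (G : graph n) (R : {set 'I_n}) (k : nat).
Let c := #|representatives G R|.
Hypotheses (k0 : 0 < k) (ck : c <= 25 * k).

Lemma token_base_large J : J <= k -> (c + J).+1 * 2 ^ c <= 2 ^ (51 * k).
Proof.
(* c + J + 1 <= 26k + 1 <= 27k <= 2^(6k), and 6 + 25 <= 51. *)
move=> Jk; apply: leq_trans (_ : 2 ^ (6 * k) * 2 ^ (25 * k) <= _).
  apply: leq_mul; last by rewrite leq_pexp2l.
  by apply: leq_trans (@linear_le_exp2 27 5 k k0 isT); lia.
by rewrite -expnD leq_pexp2l //; lia.
Qed.

Lemma target_bound : target G R (2 ^ (51 * k)) k.+1 <= 2 ^ (60 * k).
Proof.
have cQ : 2 ^ c <= 2 ^ (51 * k) by rewrite leq_pexp2l //; lia.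
have sc : \sum_(i < c) 2 ^ i <= 2 ^ c.
  by have := predn_exp 2 c; rewrite mul1n => <-; rewrite leq_pred.
have := target_repr G R (2 ^ (51 * k)).
rewrite /target mul0n addn0 -/c => ->.
set Q := 2 ^ (51 * k) in cQ *.
have lk : 32 * k <= 2 ^ (6 * k) by apply: (@linear_le_exp2 32 5).
apply: leq_trans (_ : 2 ^ (6 * k) * Q <= _); last first.
  by rewrite /Q -expnD leq_pexp2l //; lia.
apply: leq_trans (_ : 32 * k * Q <= _); last by rewrite leq_mul2r lk orbT.
(* All digit parts are bounded through 2^c <= Q; the total (27k + 3)Q is at most 32kQ because k >=
   1. *)
apply: leq_trans (_ : 25 * k * Q + Q + k.+1 * (Q + Q) <= _); last by nia.
apply: leq_add; last by rewrite leq_mul2l leq_add2l cQ orbT.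
by apply: leq_add; [rewrite leq_mul2r ck orbT | apply: leq_trans sc cQ].
Qed.

End Bounds.

(** 5 + 1 steps pay for the test on c and 4 for the final write; the slack of 1 lets [t3] also be
    the single step of [Skip]. *)
Lemma total_time w1 w2 w3 X t1 t2 t3 :
  0 < X -> t1 <= w1 * X -> t2 <= w2 * X -> t3 <= w3 * X + 1 ->
  t1 + (t2 + ((5 + t3).+1 + 4)) <= (w1 + w2 + w3 + 20) * X.
Proof. by rewrite !mulnDl; lia. Qed.

Lemma steiner_program_correct :
  exists a d, solves_steiner_clique_grid steiner_program
    (fun k n => 2 ^ (a * k) * n.+1 ^ d).
Proof.
pose W := weight component_phase + weight token_phase + weight merge_phase + 20.
pose D := depth component_phase + depth token_phase + depth merge_phase.
(* For the [M] below, M + 1 <= 2^(61k) (n + 1), whence 61 D; the factor W is at most 2^(Wk). *)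
exists (W + 61 * D), D => n G R t k cg _ k0.
set s0 := encode G R t k.
(* Dominates every loop bound that occurs: n, 51k, k + 1 and, once c <= 25k, also Y. *)
pose M := n + 2 ^ (60 * k).
have M51 : 51 * k <= M.
  apply: leq_trans (leq_addl _ _); apply: leq_trans (_ : 2 ^ (7 * k) <= _).
    by apply: leq_trans (@linear_le_exp2 64 6 k k0 isT); lia.
  by rewrite leq_pexp2l //; lia.
have ph1 := component_phase_spec G R t k; rewrite -/s0 in ph1.
set s1 := den component_phase s0 in ph1.
have ph2 := token_phase_spec ph1.
set s2 := den token_phase s1 in ph2.
have n1 : s1 a_n 0 = n by case: ph1 => [[[]]].
have n2 : s2 a_n 0 = n by case: ph2 => [[[]]].
have len1 : s1 a_len 0 = 51 * k by case: ph1 => [_ [[]]].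
have k11 : s1 a_k1 0 = k.+1 by case: ph1 => [_ [[]]].
have k12 : s2 a_k1 0 = k.+1 by case: ph2 => [_ [[]]].
have c2 : s2 a_c 0 = #|representatives G R| by case: ph2 => [_ [[]]].
have k252 : s2 a_k25 0 = 25 * k by case: ph2 => [_ [[]]].
have Y2 : s2 a_Y 0 = target G R (2 ^ (51 * k)) k.+1 by case: ph2 => [[]].
have ans2 : s2 a_ans 0 = 0 by case: ph2 => [_ [_ []]].
have nM : n <= M by apply: leq_addr.
have k1M : k.+1 <= M by apply: leq_trans M51; lia.
have m2 i : s2 a_mark i = 0 by rewrite /s2 den_frame // /s1 den_frame.
have [//||t1 e1 l1] := @exec_den component_phase s0 M.
  by apply/allP; rewrite /= nM.
have [//||t2 e2 l2] := @exec_den token_phase s1 M.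
  by apply/allP; rewrite /= n1 len1 k11 nM M51 k1M.
have pw d w : d <= D -> w * M.+1 ^ d <= w * M.+1 ^ D.
  by move=> dD; rewrite leq_mul2l leq_pexp2l ?orbT.
have bound T : T <= W * M.+1 ^ D -> T <= 2 ^ ((W + 61 * D) * k) * n.+1 ^ D.
  move=> /leq_trans; apply.
  rewrite mulnDl expnD -mulnA; apply: leq_mul.
    by apply: leq_trans (ltnW (ltn_expl W (isT : 1 < 2))) _; rewrite leq_pexp2l // leq_pmulr.
  rewrite mulnAC expnM -expnMn; rewrite leq_exp2r //.
  have -> : 61 * k = k + 60 * k by lia.
  rewrite /M expnD; have := ltn_expl k (isT : 1 < 2).
  have : 0 < 2 ^ (60 * k) by rewrite expn_gt0.
  set X := 2 ^ (60 * k); set Z := 2 ^ k; nia.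
have X0 : 0 < M.+1 ^ D by rewrite expn_gt0.
have T1 := leq_trans l1 (pw _ (weight component_phase) (leq_trans (leq_addr _ _) (leq_addr _ _))).
have T2 := leq_trans l2 (pw _ (weight token_phase) (leq_trans (leq_addl _ _) (leq_addr _ _))).
have [ck|ck] := leqP #|representatives G R| (25 * k); last first.
  eexists; exists (mem_update s2 0 0 (s2 a_ans 0)), false; split.
  - apply: exec_seq e1 (exec_seq e2 (exec_seq _ (exec_write _ _ _ _))).
    apply: exec_if_true; last exact: exec_skip.
    by rewrite -[eval _ _]/(s2 a_c 0 - s2 a_k25 0) c2 k252 subn_eq0 -ltnNge.
  - by apply: bound; apply: (@total_time _ _ _ _ t1 t2 1 X0 T1 T2); rewrite addn1.
  - by rewrite /output upd_same ans2.
  - split=> // /steiner_yesP[U [cU RU Uk]].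
    by have := card_representatives cg cU RU Uk k0; rewrite leqNgt ck.
have [//||t3 e3 l3] := @exec_den merge_phase s2 M.
  apply/allP; rewrite /= n2 k12 Y2 nM k1M.
  by rewrite (leq_trans (target_bound k0 ck)) // leq_addl.
have [ans3 yes3] := merge_phase_spec erefl (token_base_large k0 ck) ph2 m2.
set s3 := den merge_phase s2 in e3 ans3 yes3.
eexists; exists (mem_update s3 0 0 (s3 a_ans 0)), (s3 a_ans 0 != 0); split.
- apply: exec_seq e1 (exec_seq e2 (exec_seq _ (exec_write _ _ _ _))).
  apply: exec_if_false; last exact: e3.
  by rewrite -[eval _ _]/(s2 a_c 0 - s2 a_k25 0) c2 k252; apply/eqP; rewrite subn_eq0.
- apply: bound; apply: (@total_time _ _ _ _ t1 t2 t3 X0 T1 T2).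
  by apply: leq_trans (leq_trans l3 (pw _ _ _)) (leq_addr _ _); apply: leq_addl.
- by rewrite /output upd_same; case: (s3 a_ans 0) ans3 => [|[]].
- exact: yes3.
Qed.

Theorem lemma15 :
  (exists (P : program) (c d : nat),
     solves_steiner_clique_grid P (fun k n => 2 ^ (c * k) * n.+1 ^ d)) /\
  steiner_clique_grid_FPT.
Proof.
have [a [d H]] := steiner_program_correct.
split; first by exists steiner_program, a, d.
exists steiner_program, (fun k => 2 ^ (a * k)), d; split=> //.
exact: computable_exp2.
Qed.
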